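(* Let $G$ be a countable group and let $L$ be a Haagerup function on $G$. (1) If $G$ has polynomial H-growth with respect to $L$, then there exists $q\in\mathbb{N}$ such that, for every normalized 2-cocycle $\sigma$, the net $\{(1+tL)^{-q}\}_{t\to0^+}$ is a bounded Fourier summing net for $(G,\sigma)$. (2) If $G$ has subexponential H-growth with respect to $L$, then for every normalized 2-cocycle $\sigma$ the net $\{r^L\}_{r\to1^-}$ is a bounded Fourier summing net for $(G,\sigma)$.
   Context: A Haagerup function on $G$ is a negative definite function $h:G\to[0,\infty)$ which is proper ($h^{-1}([0,t])$ finite for all $t\ge0$); here negative definite means $e^{-th}$ is positive definite for all $t>0$. $\sigma:G\times G\to\mathbb{T}$ is a normalized 2-cocycle ($\sigma(g,h)\sigma(gh,k)=\sigma(h,k)\sigma(g,hk)$, $\sigma(g,e)=\sigma(e,g)=1$); $\Lambda_\sigma(g)$ is the unitary on $\ell^2(G)$ with $(\Lambda_\sigma(g)\xi)(h)=\sigma(g,g^{-1}h)\xi(g^{-1}h)$, $\lambda=\Lambda_1$; $C^*_r(G,\sigma)$ is the operator-norm closure of $\mathrm{span}\,\Lambda_\sigma(G)$; $\widehat x=x\delta_e$. $\mathcal{K}(G)$ = finitely supported functions, $\pi_\lambda(f)=\sum_g f(g)\lambda(g)$. Haagerup content of finite nonempty $E$: $c(E)=\sup\{\|\pi_\lambda(f)\|\mid \mathrm{supp}f\subseteq E,\ \|f\|_2=1\}$. With $B_{r,L}=\{g\mid L(g)\le r\}$: polynomial H-growth w.r.t. $L$ means $c(B_{r,L})\le K(1+r)^p$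 for some $K,p>0$ and all $r\ge0$; subexponential H-growth means for every $b>1$ there is $r_0$ with $c(B_{r,L})<b^r$ for all $r\ge r_0$. For $\varphi:G\to\mathbb{C}$, $M_\varphi$ is the linear map with $M_\varphi(\Lambda_\sigma(g))=\varphi(g)\Lambda_\sigma(g)$ (extended to $C^*_r(G,\sigma)$ when bounded). $MCF(G,\sigma)$ = set of $\varphi$ with $\sum_g\varphi(g)\widehat x(g)\Lambda_\sigma(g)$ norm-convergent for all $x\in C^*_r(G,\sigma)$. A Fourier summing net for $(G,\sigma)$ is a net in $MCF(G,\sigma)$ with $M_{\varphi_\alpha}(x)\to x$ in norm for all $x$; bounded means $\sup_\alpha\|M_{\varphi_\alpha}\|<\infty$. *)

(* Defs.v *)
From mathcomp Require Import all_boot all_order all_algebra.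
From mathcomp Require Import complex.
From mathcomp Require Import all_classical all_reals.
From mathcomp Require Import Rstruct.
From mathcomp Require Import normedtype sequences exp.
Set Implicit Arguments. Unset Strict Implicit. Unset Printing Implicit Defensive.
Import Order.TTheory GRing.Theory Num.Theory.
Local Open Scope ring_scope.
Local Open Scope complex_scope.

Notation R := Rdefinitions.R.
Notation C := (R[i]).

Record cgroup := CGroup {
  gcar :> countType;
  gmul : gcar -> gcar -> gcar;
  ginv : gcar -> gcar;
  gone : gcar;
  gmulA : forall x y z, gmul x (gmul y z) = gmul (gmul x y) z;
  gmul1g : forall x, gmul gone x = x;
  gmulVg : forall x, gmul (ginv x) x = gone }.

Section Defs.
Variable G : cgroup.
Local Notation e := (gone G).

Definition cabs2 (z : C) : R := (complex.Re z) ^+ 2 + (complex.Im z) ^+ 2.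

Definition is_l2 (f : G -> C) : Prop :=
  exists M : R, forall s : seq G, uniq s -> \sum_(g <- s) cabs2 (f g) <= M.

Definition l2norm (f : G -> C) : R :=
  Num.sqrt (sup [set \sum_(g <- s) cabs2 (f g) | s in [set s : seq G | uniq s]]).

(* (linear) operators, acting on functions G -> C; only their action on l^2(G)
   matters *)
Definition op := (G -> C) -> (G -> C).

Definition is_bounded_op (T : op) : Prop :=
  [/\ forall f, is_l2 f -> is_l2 (T f),
      forall (a : C) f g, is_l2 f -> is_l2 g ->
        T (fun h => a * f h + g h) = (fun h => a * T f h + T g h)
    & exists M : R, forall f, is_l2 f -> l2norm (T f) <= M * l2norm f].

Definition opnorm (T : op) : R :=
  sup [set l2norm (T f) | f in [set f | is_l2 f /\ l2norm f <= 1]].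

Definition opsub (T S : op) : op := fun f h => T f h - S f h.

Definition cocycle (sigma : G -> G -> C) : Prop :=
  [/\ forall g h, cabs2 (sigma g h) = 1,
      forall g h k, sigma g h * sigma (gmul g h) k = sigma h k * sigma g (gmul h k)
    & forall g, sigma g e = 1 /\ sigma e g = 1].

Definition Lam (sigma : G -> G -> C) (g : G) : op :=
  fun xi h => sigma g (gmul (ginv g) h) * xi (gmul (ginv g) h).

Definition pi_fs (sigma : G -> G -> C) (s : seq G) (c : G -> C) : op :=
  fun xi h => \sum_(g <- s) c g * Lam sigma g xi h.

Definition in_Cred (sigma : G -> G -> C) (x : op) : Prop :=
  is_bounded_op x /\
  forall eps : R, 0 < eps ->
    exists (s : seq G) (c : G -> C), opnorm (opsub x (pi_fs sigma s c)) < eps.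

Definition delta_e : G -> C := fun h => if h == e then 1 else 0.

Definition xhat (x : op) : G -> C := x delta_e.

(* MRel sigma phi x y : the series sum_g phi(g) \hat x(g) Lambda_sigma(g)
   converges in operator norm (unconditionally, i.e. along the net of finite
   subsets of G) to y; then y = M_phi(x). *)
Definition MRel (sigma : G -> G -> C) (phi : G -> C) (x y : op) : Prop :=
  is_bounded_op y /\
  forall eps : R, 0 < eps ->
    exists F0 : seq G, forall F : seq G, uniq F -> {subset F0 <= F} ->
      opnorm (opsub y (pi_fs sigma F (fun g => phi g * xhat x g))) < eps.

Definition MCF (sigma : G -> G -> C) (phi : G -> C) : Prop :=
  forall x, in_Cred sigma x -> exists y, MRel sigma phi x y.

Definition bounded_FSN (sigma : G -> G -> C) (D : R -> Prop) (a : R)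
    (Phi : R -> G -> C) : Prop :=
  [/\ forall t, D t -> MCF sigma (Phi t),
      forall x, in_Cred sigma x -> forall eps : R, 0 < eps ->
        exists2 delta : R, 0 < delta & forall t, D t -> `|t - a| < delta ->
          forall y, MRel sigma (Phi t) x y -> opnorm (opsub y x) < eps
    & exists K : R, forall t, D t -> forall x, in_Cred sigma x ->
          forall y, MRel sigma (Phi t) x y -> opnorm y <= K * opnorm x].

Definition pos_def (phi : G -> C) : Prop :=
  forall (n : nat) (g : 'I_n -> G) (c : 'I_n -> C),
    0 <= \sum_(i < n) \sum_(j < n) (c i)^* * c j * phi (gmul (ginv (g i)) (g j)).

Definition neg_def (h : G -> R) : Prop :=
  forall t : R, 0 < t -> pos_def (fun g => (expR (- (t * h g)))%:C).

Definition haagerup (h : G -> R) : Prop :=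
  [/\ forall g, 0 <= h g, neg_def h
    & forall t : R, exists s : seq G, forall g, h g <= t -> g \in s].

Definition trivial_cocycle : G -> G -> C := fun _ _ => 1.

Definition hcontent (P : G -> Prop) : R :=
  sup [set v : R | exists (s : seq G) (f : G -> C),
         [/\ uniq s, (forall g, g \in s -> P g), (forall g, g \notin s -> f g = 0), l2norm f = 1
            & v = opnorm (pi_fs trivial_cocycle s f)]].

Definition ball (L : G -> R) (r : R) : G -> Prop := fun g => L g <= r.

Definition poly_Hgrowth (L : G -> R) : Prop :=
  exists K p : R, [/\ 0 < K, 0 < p &
    forall r : R, 0 <= r -> hcontent (ball L r) <= K * (1 + r) `^ p].

Definition subexp_Hgrowth (L : G -> R) : Prop :=
  forall b : R, 1 < b -> exists r0 : R, forall r : R, r0 <= r ->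
    hcontent (ball L r) < b `^ r.

End Defs.

(* Main.v *)
(** Two estimates drive the proof.  (i) An operator [x] of the twisted reduced
    C*-algebra has the matrix [xhat x (h k^-1) * sigma (h k^-1) k], so
    [M_phi] acts on it as Schur multiplication by the kernel [phi (h k^-1)].
    For [phi = exp (- t L)] this kernel is positive definite with diagonal at
    most 1, and writing it as [B^* B] bounds the multiplier by 1.  The
    resolvent [1 / (1 + t L)] is a uniform limit of Riemann sums of
    [exp (- s (1 + t L)) ds], so it and its powers are multipliers of norm at
    most 1 too.  (ii) A twisted convolver is dominated pointwise by the
    untwisted convolver of the absolute value.  Cutting [G] into the shells
    [n <= L g < n + 1], the norm of the tail of [sum_g phi g xhat x g Lam g] is
    at most [|xhat x|_2] times the tail of [sum_n c(B_(n+1)) sup_(L >= n) |phi|],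
    which converges under either growth hypothesis.  The resulting series
    converges unconditionally, and uniform boundedness reduces the convergence
    of the net to finitely supported elements. *)

Require Import Defs.
From mathcomp Require Import all_boot all_order all_algebra.
From mathcomp Require Import complex.
From mathcomp Require Import all_classical all_reals.
From mathcomp Require Import Rstruct.
From mathcomp Require Import normedtype sequences exp.
From mathcomp Require Import spectral sesquilinear.
From mathcomp Require Import ring lra.
Set Implicit Arguments. Unset Strict Implicit. Unset Printing Implicit Defensive.
Import Order.TTheory GRing.Theory Num.Theory.
Import ComplexField.Normc numFieldNormedType.Exports.
Local Open Scope ring_scope.
Local Open Scope complex_scope.

(** * Finite Euclidean norms *)

Lemma cabs2E (z : C) : cabs2 z = normc z ^+ 2.
Proof. by case: z => a b; rewrite /cabs2 /= sqr_sqrtr // addr_ge0 ?sqr_ge0. Qed.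

Lemma normc_ge0 (z : C) : 0 <= normc z.
Proof. by case: z => a b; exact: sqrtr_ge0. Qed.

Lemma normcD (x y : C) : normc (x + y) <= normc x + normc y.
Proof. exact: le_normcD. Qed.

Lemma normcB (x y : C) : normc (x - y) <= normc x + normc y.
Proof. by rewrite -(normcN y); exact: normcD. Qed.

Lemma normcBC (x y : C) : normc (x - y) = normc (y - x).
Proof. by rewrite -normcN opprB. Qed.

Lemma normcR (x : R) : normc x%:C = `|x|.
Proof. by rewrite /= expr0n addr0 sqrtr_sqr. Qed.

Lemma normc_conj (z : C) : normc (conjc z) = normc z.
Proof. by case: z => a b /=; rewrite sqrrN. Qed.

Lemma normc_unit (z : C) : cabs2 z = 1 -> normc z = 1.
Proof.
rewrite cabs2E => z1; apply/eqP.
by rewrite -(@eqrXn2 _ 2) ?ler01 ?normc_ge0 // z1 expr1n.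
Qed.

Lemma mulc_conj (z : C) : z * conjc z = (normc z ^+ 2)%:C.
Proof.
rewrite -cabs2E; case: z => a b; rewrite /cabs2 /=.
by simpc; rewrite -!expr2 [b * a]mulrC addNr.
Qed.

Lemma normc_sum (I : Type) (s : seq I) (P : pred I) (F : I -> C) :
  normc (\sum_(i <- s | P i) F i) <= \sum_(i <- s | P i) normc (F i).
Proof.
elim/big_rec2: _ => [|i x y _ IH]; first by rewrite (@normc0 R).
by apply: (le_trans (normcD _ _)); rewrite lerD2l.
Qed.

Lemma normc_lim0 (z : C) : (forall eps : R, 0 < eps -> normc z <= eps) -> z = 0.
Proof.
move=> H; apply: eq0_normc; apply/eqP; rewrite eq_le normc_ge0 andbT.
by apply/ler_addgt0Pl => e e0; rewrite addr0; exact: H.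
Qed.

Lemma cauchy_schwarz_seq (I : Type) (s : seq I) (a b : I -> R) :
  (forall i, 0 <= a i) -> (forall i, 0 <= b i) ->
  \sum_(i <- s) a i * b i <=
    Num.sqrt (\sum_(i <- s) a i ^+ 2) * Num.sqrt (\sum_(i <- s) b i ^+ 2).
Proof.
move=> a0 b0; elim: s => [|i s IH]; first by rewrite !big_nil sqrtr0 mul0r.
have sq0 (c : I -> R) : 0 <= \sum_(i <- s) c i ^+ 2.
  by apply: sumr_ge0 => j _; exact: sqr_ge0.
rewrite !big_cons -sqrtrM ?addr_ge0 ?sqr_ge0 ?sq0 //.
move: IH (sqr_sqrtr (sq0 a)) (sqr_sqrtr (sq0 b)).
move: (sqrtr_ge0 (\sum_(j <- s) a j ^+ 2)) (sqrtr_ge0 (\sum_(j <- s) b j ^+ 2)).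
set p := Num.sqrt _; set q := Num.sqrt _ => p0 q0 IH <- <-.
apply: le_trans (_ : a i * b i + p * q <= _); first by rewrite lerD2l.
rewrite -[leLHS]ger0_norm ?addr_ge0 ?mulr_ge0 // -sqrtr_sqr; apply: ler_wsqrtr.
(* The square of the right side minus that of the left is exactly this square. *)
have := sqr_ge0 (a i * q - b i * p); nra.
Qed.

Section FiniteNorm.
Variable T : choiceType.
Implicit Types (s : seq T) (u v : T -> C).

Definition nrm s u : R := Num.sqrt (\sum_(h <- s) normc (u h) ^+ 2).

Lemma nrm_ge0 s u : 0 <= nrm s u. Proof. exact: sqrtr_ge0. Qed.

Lemma sum_normc2_ge0 s u : 0 <= \sum_(h <- s) normc (u h) ^+ 2.
Proof. by apply: sumr_ge0 => j _; exact: sqr_ge0. Qed.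

Lemma sqr_nrm s u : nrm s u ^+ 2 = \sum_(h <- s) normc (u h) ^+ 2.
Proof. by rewrite sqr_sqrtr // sum_normc2_ge0. Qed.

Lemma nrm_le s u (M : R) : 0 <= M ->
  (nrm s u <= M) = (\sum_(h <- s) normc (u h) ^+ 2 <= M ^+ 2).
Proof. by move=> M0; rewrite -sqr_nrm ler_sqr ?nnegrE ?nrm_ge0. Qed.

Lemma ler_nrm s u v : (forall h, h \in s -> normc (u h) <= normc (v h)) ->
  nrm s u <= nrm s v.
Proof.
move=> H; rewrite /nrm ler_wsqrtr // big_seq [leRHS]big_seq ler_sum // => h hs.
by rewrite ler_sqr ?nnegrE ?normc_ge0 // H.
Qed.

Lemma eq_nrm s u v : (forall h, h \in s -> normc (u h) = normc (v h)) ->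
  nrm s u = nrm s v.
Proof. by move=> H; apply/eqP; rewrite eq_le !ler_nrm // => h /H ->. Qed.

Lemma nrmD s u v : nrm s (fun h => u h + v h) <= nrm s u + nrm s v.
Proof.
rewrite nrm_le ?addr_ge0 ?nrm_ge0 // sqrrD !sqr_nrm.
apply: le_trans (_ : \sum_(h <- s) (normc (u h) + normc (v h)) ^+ 2 <= _).
  apply: ler_sum => h _; rewrite ler_sqr ?nnegrE ?addr_ge0 ?normc_ge0 //.
  exact: normcD.
under eq_bigr do rewrite sqrrD.
rewrite big_split big_split /= lerD2r lerD2l sumrMnl ler_wMn2r //.
by apply: cauchy_schwarz_seq => i; exact: normc_ge0.
Qed.

Lemma nrmZ s a u : nrm s (fun h => a * u h) = normc a * nrm s u.
Proof.
rewrite /nrm; under eq_bigr do rewrite normcM exprMn.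
by rewrite -mulr_sumr sqrtrM ?sqr_ge0 // sqrtr_sqr ger0_norm ?normc_ge0.
Qed.

Lemma normc_le_nrm s u h : h \in s -> normc (u h) <= nrm s u.
Proof.
move=> hs; rewrite -[leLHS]ger0_norm ?normc_ge0 // -sqrtr_sqr ler_wsqrtr //.
by rewrite (big_rem h) //= lerDl; exact: sum_normc2_ge0.
Qed.

Lemma nrm_le_sum s u : nrm s u <= \sum_(h <- s) normc (u h).
Proof.
have n0 l : 0 <= \sum_(h <- l) normc (u h).
  by apply: sumr_ge0 => h _; exact: normc_ge0.
rewrite nrm_le //; elim: s => [|h s IH]; first by rewrite !big_nil expr0n.
rewrite !big_cons sqrrD -addrA lerD2l (le_trans IH) // lerDr.
by rewrite mulrn_wge0 // mulr_ge0 ?normc_ge0.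
Qed.

Lemma nrm_le_cst s u (d : R) : (forall h, h \in s -> normc (u h) <= d) ->
  nrm s u <= (size s)%:R * d.
Proof.
move=> H; apply: le_trans (nrm_le_sum s u) _.
rewrite big_seq; apply: le_trans (_ : \sum_(h <- s | h \in s) d <= _).
  exact: ler_sum.
by rewrite -big_seq big_const_seq count_predT iter_addr_0 mulr_natl.
Qed.

Lemma cauchy_schwarz_nrm s u v :
  normc (\sum_(h <- s) u h * v h) <= nrm s u * nrm s v.
Proof.
apply: (le_trans (normc_sum _ _ _)); under eq_bigr do rewrite normcM.
by apply: cauchy_schwarz_seq => i; exact: normc_ge0.
Qed.

Lemma nrm_sub s s' u : uniq s -> {subset s <= s'} -> nrm s u <= nrm s' u.
Proof.
move=> us ss; rewrite /nrm ler_wsqrtr //.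
have /permPl p := perm_filterC (mem s) s'.
rewrite -(perm_big _ p) big_cat /=.
(* [s'] may repeat elements, so its part inside [s] is a permutation of [s] only after [undup]. *)
apply: le_trans (_ : \sum_(h <- undup [seq x <- s' | mem s x]) normc (u h) ^+ 2 <= _).
  rewrite le_eqVlt; apply/orP; left; apply/eqP/perm_big/uniq_perm => //.
    exact: undup_uniq.
  move=> x; rewrite mem_undup mem_filter /=.
  by apply/idP/andP => [xs|[]//]; split => //; exact: ss.
apply: le_trans (_ : \sum_(h <- [seq x <- s' | mem s x]) normc (u h) ^+ 2 <= _);
  last by rewrite lerDl sum_normc2_ge0.
elim: [seq x <- s' | mem s x] => //= x l IH; rewrite big_cons.
case: ifP => _; last by rewrite big_cons lerD2l.
by apply: le_trans IH _; rewrite lerDr sqr_ge0.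
Qed.

End FiniteNorm.

(** * Bounded operators on l^2(G) *)

Section Operators.
Variable G : cgroup.
Local Notation e := (gone G).
Implicit Types (f u v xi : G -> C) (s F : seq G) (T S x y : op G)
  (sigma : G -> G -> C).

Lemma gmulgV (g : G) : gmul g (ginv g) = e.
Proof.
rewrite -[LHS]gmul1g -{1}(gmulVg (ginv g)) -gmulA.
by rewrite [gmul (ginv g) _]gmulA gmulVg gmul1g gmulVg.
Qed.

Lemma gmulg1 (g : G) : gmul g e = g.
Proof. by rewrite -(gmulVg g) gmulA gmulgV gmul1g. Qed.

Lemma gmulKV (g h : G) : gmul g (gmul (ginv g) h) = h.
Proof. by rewrite gmulA gmulgV gmul1g. Qed.

Lemma gmulVK (g h : G) : gmul (ginv g) (gmul g h) = h.
Proof. by rewrite gmulA gmulVg gmul1g. Qed.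

Lemma ginvK (g : G) : ginv (ginv g) = g.
Proof. by rewrite -[LHS]gmulg1 -(gmulVg g) gmulA gmulVg gmul1g. Qed.

Lemma gmul_injl (g : G) : injective (gmul g).
Proof. by apply: (can_inj (g := gmul (ginv g))) => h; exact: gmulVK. Qed.

Lemma gmulVg_eq (g h k : G) : (gmul (ginv g) h == k) = (g == gmul h (ginv k)).
Proof.
apply/eqP/eqP => [kE|->]; first by rewrite -(gmulKV g h) kE -gmulA gmulgV gmulg1.
by apply: (@gmul_injl (gmul h (ginv k))); rewrite gmulKV -gmulA gmulVg gmulg1.
Qed.

(** Records membership in l^2 and the norm bound at once, whereas [l2norm] alone takes a default
    value outside l^2. *)
Definition l2le f (M : R) := forall s, uniq s -> nrm s f <= M.

Lemma l2le_ge0 f M : l2le f M -> 0 <= M.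
Proof. by move=> /(_ [::] erefl); apply: le_trans; exact: nrm_ge0. Qed.

Lemma l2le_is_l2 f M : l2le f M -> is_l2 f.
Proof.
move=> fM; exists (M ^+ 2) => s us.
under eq_bigr do rewrite cabs2E.
by rewrite -nrm_le ?fM // (l2le_ge0 fM).
Qed.

Lemma l2norm_le f M : l2le f M -> l2norm f <= M.
Proof.
move=> fM; have M0 := l2le_ge0 fM.
rewrite -(ger0_norm M0) -sqrtr_sqr; apply: ler_wsqrtr; apply: ge_sup.
  by exists (\sum_(g <- [::]) cabs2 (f g)); exists [::].
move=> _ [s us <-]; under eq_bigr do rewrite cabs2E.
by rewrite -nrm_le ?fM.
Qed.

Lemma is_l2_le f : is_l2 f -> l2le f (l2norm f).
Proof.
move=> [M fM] s us; apply: ler_wsqrtr; under eq_bigr do rewrite -cabs2E.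
by apply: ub_le_sup; [exists M => _ [l ul <-]; exact: fM|exists s].
Qed.

Lemma l2norm_ge0 f : 0 <= l2norm f.
Proof. exact: sqrtr_ge0. Qed.

Lemma l2le_weak f M N : M <= N -> l2le f M -> l2le f N.
Proof. by move=> MN fM s us; exact: le_trans (fM s us) MN. Qed.

Lemma l2le_mono f u M : (forall h, normc (f h) <= normc (u h)) ->
  l2le u M -> l2le f M.
Proof. by move=> fu uM s us; apply: le_trans (uM s us); exact: ler_nrm. Qed.

Lemma l2leD f u M N : l2le f M -> l2le u N -> l2le (fun h => f h + u h) (M + N).
Proof.
by move=> fM uN s us; apply: le_trans (nrmD _ _ _) _; rewrite lerD ?fM ?uN.
Qed.

Lemma l2leZ a f M : l2le f M -> l2le (fun h => a * f h) (normc a * M).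
Proof. by move=> fM s us; rewrite nrmZ ler_wpM2l ?normc_ge0 ?fM. Qed.

Lemma l2leB f u M N : l2le f M -> l2le u N -> l2le (fun h => f h - u h) (M + N).
Proof.
move=> fM uN; apply: l2leD => //.
by apply: l2le_mono uN => h; rewrite normcN.
Qed.

(** Closed balls of l^2 are closed under pointwise limits: each partial norm sees finitely many
    coordinates, and an error [d] on each of them costs at most [size s] times [d]. *)
Lemma l2le_lim f M :
  (forall s (d : R), 0 < d -> exists2 u, l2le u M &
     forall h, h \in s -> normc (f h - u h) <= d) ->
  l2le f M.
Proof.
move=> H s us; apply/ler_addgt0Pl => d d0.
have s0 : 0 < (size s)%:R + 1 :> R by rewrite ltr_wpDl.
have [u uM fu] := H s _ (divr_gt0 d0 s0).
have -> : nrm s f = nrm s (fun h => (f h - u h) + u h).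
  by apply: eq_nrm => h _; rewrite subrK.
apply: le_trans (nrmD _ _ _) _; rewrite lerD ?uM //.
apply: le_trans (nrm_le_cst fu) _.
by rewrite mulrA ler_pdivrMr // mulrC ler_pM2l // lerDl.
Qed.

Lemma l2le0 : l2le (fun=> 0) 0.
Proof.
move=> s _; apply: le_trans (nrm_le_sum _ _) _.
by rewrite big1 // => h _; exact: (@normc0 R).
Qed.

Definition delta (k : G) : G -> C := fun h => if h == k then 1 else 0.

Lemma l2le_delta k : l2le (delta k) 1.
Proof.
move=> s us; rewrite nrm_le ?ler01 // expr1n.
apply: le_trans (_ : \sum_(h <- s) (h == k)%:R <= _).
  by apply: ler_sum => h _; rewrite /delta; case: eqP => _;
    rewrite ?(@normc0 R) ?(@normc1 R) ?expr0n ?expr1n.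
by rewrite -natr_sum -big_mkcond sum1_count count_uniq_mem // lern1; case: (_ \in _).
Qed.

(* Unlike [opnorm], whose supremum is [0] on unbounded operators, [ople] does not
   presuppose that [T] is bounded. *)
Definition ople T (M : R) := forall f N, l2le f N -> l2le (T f) (M * N).

Definition lin_op T := forall (a : C) f u, is_l2 f -> is_l2 u ->
  T (fun h => a * f h + u h) = (fun h => a * T f h + T u h).

Lemma ople_bounded T M : lin_op T -> ople T M -> is_bounded_op T.
Proof.
move=> lT TM; split=> //.
  by move=> f /is_l2_le /TM /l2le_is_l2.
by exists M => f /is_l2_le /TM /l2norm_le.
Qed.

Lemma bounded_lin T : is_bounded_op T -> lin_op T.
Proof. by case. Qed.

Lemma lin_op0 T : lin_op T -> T (fun=> 0) = (fun=> 0).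
Proof.
move=> lT; apply/funext => h.
have l0 := l2le_is_l2 l2le0.
have := congr1 (fun f => f h) (lT 1 _ _ l0 l0).
have -> : (fun h0 : G => 1 * 0 + 0) = (fun=> 0) :> (G -> C).
  by apply/funext => k; rewrite mulr0 addr0.
by move=> /eqP; rewrite mul1r -subr_eq0 opprD addNKr oppr_eq0 => /eqP.
Qed.

Lemma lin_opZ T a f : lin_op T -> is_l2 f ->
  T (fun h => a * f h) = (fun h => a * T f h).
Proof.
move=> lT lf; rewrite (_ : (fun h => a * f h) = (fun h => a * f h + 0)).
  rewrite lT ?lin_op0 //; last exact: l2le_is_l2 l2le0.
  by apply/funext => h; rewrite addr0.
by apply/funext => h; rewrite addr0.
Qed.

(** A set without a supremum has [sup] equal to [0], so this case is covered too. *)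
Lemma sup_ge0 (A : set R) : (forall a, A a -> 0 <= a) -> 0 <= sup A.
Proof.
move=> A0; have [[[a Aa] ub]|/sup_out->//] := pselect (has_sup A).
by apply: le_trans (A0 _ Aa) _; exact: ub_le_sup.
Qed.

Lemma opnorm_ge0 T : 0 <= opnorm T.
Proof. by apply: sup_ge0 => _ [f _ <-]; exact: l2norm_ge0. Qed.

Lemma opnorm_le T M : 0 <= M -> ople T M -> opnorm T <= M.
Proof.
move=> M0 TM; apply: ge_sup.
  exists (l2norm (T (fun=> 0))), (fun=> 0) => //; split.
    exact: l2le_is_l2 l2le0.
  by apply: le_trans ler01; apply: l2norm_le l2le0.
move=> _ [f [lf f1] <-]; apply: l2norm_le; rewrite -[M]mulr1.
by apply: TM; exact: l2le_weak f1 (is_l2_le lf).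
Qed.

Lemma ople_opnorm T : is_bounded_op T -> ople T (opnorm T).
Proof.
move=> [Tl2 lT [M TM]].
have unit f : l2le f 1 -> l2norm (T f) <= opnorm T.
  move=> f1; apply: ub_le_sup; last first.
    by exists f => //; split; [exact: l2le_is_l2 f1|exact: l2norm_le].
  exists `|M| => _ [u [lu u1] <-].
  apply: le_trans (TM _ lu) _.
  apply: le_trans (_ : `|M| * l2norm u <= _).
    by rewrite ler_wpM2r ?l2norm_ge0 // ler_norm.
  by rewrite ler_piMr.
move=> f N fN; have N0 := l2le_ge0 fN; have lf := l2le_is_l2 fN.
move=> s us; apply/ler_addgt0Pl => d d0.
have oT1 : 0 < opnorm T + 1 by rewrite ltr_wpDl ?opnorm_ge0.
(* [f] is rescaled into the unit ball. The excess over [N] keeps [c] positive when [N = 0] and costs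
   at most [d] in the final bound. *)
pose c := N + d / (opnorm T + 1).
have c0 : 0 < c by rewrite ltr_wpDl // divr_gt0.
have nc : normc (c^-1)%:C = c^-1 by rewrite normcR ger0_norm // invr_ge0 ltW.
have /unit : l2le (fun h => (c^-1)%:C * f h) 1.
  apply: l2le_weak (l2leZ _ fN); rewrite nc mulrC ler_pdivrMr // mul1r.
  by rewrite lerDl divr_ge0 // ltW.
rewrite lin_opZ // => H.
have : l2le (fun h => (c^-1)%:C * T f h) (opnorm T).
  apply: l2le_weak H _; apply: is_l2_le; apply: l2le_is_l2.
  by apply: l2leZ; apply: is_l2_le; exact: Tl2.
move=> /(_ s us); rewrite nrmZ nc mulrC ler_pdivrMr // => /le_trans; apply.
rewrite mulrDr addrC lerD2r mulrCA ler_piMr ?(ltW d0) //.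
by rewrite ler_pdivrMr // mul1r lerDl.
Qed.

Lemma ople_weak T M N : M <= N -> ople T M -> ople T N.
Proof.
move=> MN TM f K fK; apply: l2le_weak (TM _ _ fK).
by rewrite ler_wpM2r // (l2le_ge0 fK).
Qed.

Lemma ople_sub T S M N : ople T M -> ople S N -> ople (opsub T S) (M + N).
Proof. by move=> TM SN f K fK; rewrite mulrDl; apply: l2leB; [exact: TM|exact: SN]. Qed.

Lemma lin_sub T S : lin_op T -> lin_op S -> lin_op (opsub T S).
Proof.
move=> lT lS a f u lf lu; apply/funext => h; rewrite /opsub lT // lS //.
by rewrite mulrBr opprD addrACA.
Qed.

Lemma bounded_sub T S : is_bounded_op T -> is_bounded_op S ->
  is_bounded_op (opsub T S).
Proof.
move=> bT bS; apply: (@ople_bounded _ (opnorm T + opnorm S)).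
  by apply: lin_sub; exact: bounded_lin.
by apply: ople_sub; exact: ople_opnorm.
Qed.

Lemma l2le_translate g f N : l2le f N -> l2le (fun h => f (gmul g h)) N.
Proof.
move=> fN s us; have := fN (map (gmul g) s).
rewrite map_inj_uniq; last exact: gmul_injl.
by move=> /(_ us); rewrite /nrm big_map.
Qed.

Lemma l2le_Lam sigma g f N : (forall g h, cabs2 (sigma g h) = 1) ->
  l2le f N -> l2le (Lam sigma g f) N.
Proof.
move=> s1 fN; apply: l2le_mono (l2le_translate (ginv g) fN) => h.
by rewrite /Lam normcM normc_unit ?mul1r.
Qed.

Lemma pi_fs_cons sigma g s c f :
  pi_fs sigma (g :: s) c f = fun h => c g * Lam sigma g f h + pi_fs sigma s c f h.
Proof. by apply/funext => h; rewrite /pi_fs big_cons. Qed.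

Lemma ople_pi_fs_sum sigma s c : (forall g h, cabs2 (sigma g h) = 1) ->
  ople (pi_fs sigma s c) (\sum_(g <- s) normc (c g)).
Proof.
move=> s1 f N fN; elim: s => [|g s IH].
  rewrite big_nil mul0r (_ : pi_fs _ _ _ _ = fun=> 0); first exact: l2le0.
  by apply/funext => h; rewrite /pi_fs big_nil.
rewrite big_cons mulrDl pi_fs_cons; apply: l2leD IH.
by apply: l2leZ; exact: l2le_Lam.
Qed.

Lemma lin_pi_fs sigma s c : lin_op (pi_fs sigma s c).
Proof.
move=> a f u _ _; apply/funext => h; rewrite /pi_fs mulr_sumr -big_split /=.
by apply: eq_bigr => g _; rewrite /Lam; ring.
Qed.

Lemma bounded_pi_fs sigma s c : (forall g h, cabs2 (sigma g h) = 1) ->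
  is_bounded_op (pi_fs sigma s c).
Proof.
by move=> s1; apply: ople_bounded (ople_pi_fs_sum s c s1); exact: lin_pi_fs.
Qed.

(** The inner sum is there because [s] may list the group element [h k^-1] several times or not at
    all. *)
Lemma pi_fs_delta sigma s c h k :
  pi_fs sigma s c (delta k) h =
  (\sum_(g <- s | g == gmul h (ginv k)) c g) * sigma (gmul h (ginv k)) k.
Proof.
rewrite /pi_fs mulr_suml [RHS]big_mkcond; apply: eq_bigr => g _.
rewrite /Lam /delta gmulVg_eq; case: eqP => [->|_]; last by rewrite !mulr0.
rewrite mulr1; congr (_ * sigma _ _).
by apply/eqP; rewrite gmulVg_eq.
Qed.

Lemma ople_entry T M h k : ople T M -> normc (T (delta k) h) <= M.
Proof.
move=> TM; have := TM _ _ (l2le_delta k) [:: h] erefl; rewrite mulr1.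
by apply: le_trans; apply: normc_le_nrm; rewrite inE.
Qed.

Lemma entry_lt T eps h k : is_bounded_op T -> opnorm T < eps ->
  normc (T (delta k) h) <= eps.
Proof.
move=> bT /ltW Te; apply: le_trans Te; apply: ople_entry; exact: ople_opnorm.
Qed.

(** For finite sums this is [pi_fs_delta], compared at [(h, k)] and [(h k^-1, e)]. Matrix entries
    are bounded by the operator norm, so the identity passes to norm limits. *)
Lemma Cred_entry sigma x h k : cocycle sigma -> in_Cred sigma x ->
  x (delta k) h = xhat x (gmul h (ginv k)) * sigma (gmul h (ginv k)) k.
Proof.
move=> [s1 _ se] [bx xa]; apply/eqP; rewrite -subr_eq0; apply/eqP.
apply: normc_lim0 => eps e0.
have [s [c xs]] := xa _ (divr_gt0 e0 (ltr0Sn _ 1)).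
have bd : is_bounded_op (opsub x (pi_fs sigma s c)).
  by apply: bounded_sub => //; exact: bounded_pi_fs.
have H1 := entry_lt h k bd xs.
have H2 := entry_lt (gmul h (ginv k)) e bd xs.
have einv : ginv e = e by rewrite -[LHS]gmulg1 gmulVg.
move: H1 H2; rewrite /opsub !pi_fs_delta einv gmulg1 (se _).1 mulr1.
rewrite -[delta e]/(@delta_e G) -/(xhat x).
set w := \sum_(_ <- _ | _) _; set z := sigma _ _; set a := x _ _; set b := xhat _ _.
move=> H1 H2; have -> : a - b * z = (a - w * z) - (b - w) * z by ring.
apply: le_trans (normcB _ _) _; rewrite normcM (normc_unit (s1 _ _)).
lra.
Qed.

Lemma MRel_entry sigma phi x y h k : cocycle sigma -> in_Cred sigma x ->
  MRel sigma phi x y ->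
  y (delta k) h = phi (gmul h (ginv k)) * x (delta k) h.
Proof.
move=> cs xC [by_ yl]; rewrite (Cred_entry _ _ cs xC); have [s1 _ _] := cs.
apply/eqP; rewrite -subr_eq0; apply/eqP; apply: normc_lim0 => eps e0.
(* Adding [g] to [F0] and removing duplicates makes [g] occur exactly once, so the entry of the
   partial sum is already the final value. *)
have [F0 yF] := yl _ e0; set g := gmul h (ginv k).
have /yF := undup_uniq (g :: F0).
have F0s : {subset F0 <= undup (g :: F0)}.
  by move=> l lF; rewrite mem_undup inE lF orbT.
move=> /(_ F0s) /entry_lt - /(_ h k).
rewrite /opsub pi_fs_delta -/g -big_filter filter_pred1_uniq ?undup_uniq //;
  last by rewrite mem_undup inE eqxx.
rewrite big_seq1 mulrA; apply.
by apply: bounded_sub => //; exact: bounded_pi_fs.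
Qed.

End Operators.

(** * Schur multipliers *)

Lemma conjCE (z : C) : Num.conj z = conjc z.
Proof. by []. Qed.

(** * Factorisation of positive semidefinite complex matrices *)

Section PosSemidef.
Local Open Scope sesquilinear_scope.
Variables (n : nat) (P : 'M[C]_n).
Hypothesis P0 : forall c : 'I_n -> C,
  0 <= \sum_(i < n) \sum_(j < n) conjc (c i) * c j * P i j.

(** Polarisation: the form is real at [e_i + z e_j], and [z = 1], [z = i] give the imaginary and the
    real part of the claim. *)
Lemma psd_hermitian i j : P j i = conjc (P i j).
Proof.
have ev (F : 'I_n -> C) (z : C) :
    \sum_l ((l == i)%:R + z * (l == j)%:R) * F l = F i + z * F j.
  under eq_bigr do rewrite mulrDl -mulrA.
  rewrite big_split /= -mulr_sumr; congr (_ + _ * _).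
    by rewrite (bigD1 i) //= eqxx mul1r big1 ?addr0 // => l /negPf ->; rewrite mul0r.
  by rewrite (bigD1 j) //= eqxx mul1r big1 ?addr0 // => l /negPf ->; rewrite mul0r.
have cj (z : C) (a b : bool) : conjc (a%:R + z * b%:R) = a%:R + conjc z * b%:R.
  by case: z => z1 z2; case: a; case: b; simpc.
have q z : 0 <= P i i + z * P i j + conjc z * (P j i + z * P j j).
  have := P0 (fun l => (l == i)%:R + z * (l == j)%:R).
  under eq_bigr => l _.
    under eq_bigr => m _ do rewrite -mulrA.
    rewrite -mulr_sumr (ev (P l)) cj.
  over.
  by rewrite (ev (fun l => P l i + z * P l j)).
have qi k : 0 <= P k k.
  have := P0 (fun l => (l == k)%:R).
  rewrite (bigD1 k) //= [X in _ + X]big1 ?addr0; last first.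
    by move=> l /negPf lk; rewrite big1 // => m _; rewrite lk conjc0 !mul0r.
  rewrite (bigD1 k) //= [X in _ + X]big1 ?addr0; last first.
    by move=> l /negPf lk; rewrite lk mulr0 mul0r.
  by rewrite eqxx conjc1 !mul1r.
have := ger0_Im (q 1); have := ger0_Im (q (Complex 0 1)).
have := ger0_Im (qi i); have := ger0_Im (qi j).
case: (P i i) (P j j) (P i j) (P j i) => [a a'] [b b'] [c c'] [d d'] /=.
move=> -> -> h1 h2; congr (_ +i* _); lra.
Qed.

(** By the spectral theorem [P] is the conjugate of a diagonal matrix by a unitary [U]; [B] is the
    square root of the diagonal times [U]. *)
Lemma psd_factor : exists B : 'M[C]_n,
  forall i j, P i j = \sum_k conjc (B k i) * B k j.
Proof.
have hP : P \is hermsymmx.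
  apply/is_hermitianmxP; rewrite expr0 scale1r; apply/matrixP => i j.
  by rewrite !mxE conjCE -psd_hermitian.
have /hermitian_normalmx/orthomx_spectralP := hP.
set U := spectralmx P; set d := spectral_diag P => PE.
have Uu : U \is unitarymx := spectral_unitarymx P.
rewrite invmx_unitary // in PE.
(* The eigenvalue [d 0 k] is the value of the form at the conjugate of the [k]-th row of [U]. *)
have d0 k : 0 <= d 0 k.
  have dE : U *m P *m U^t* = diag_mx d.
    rewrite PE !mulmxA (unitarymxP Uu) mul1mx -mulmxA.
    by rewrite (unitarymxP Uu) mulmx1.
  have -> : d 0 k = \sum_i \sum_j conjc (conjc (U k i)) * conjc (U k j) * P i j.
    move/matrixP/(_ k k): dE; rewrite mxE [in RHS]mxE eqxx mulr1n => <-.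
    under eq_bigr => j _ do rewrite mxE big_distrl /=.
    rewrite exchange_big /=; apply: eq_bigr => i _; apply: eq_bigr => j _.
    by rewrite !mxE conjcK conjCE mulrAC.
  exact: P0.
exists (\matrix_(k, j) (sqrtC (d 0 k) * U k j)) => i j.
rewrite {1}PE mxE; apply: eq_bigr => k _; rewrite !mxE.
have sq : conjc (sqrtC (d 0 k)) = sqrtC (d 0 k).
  by rewrite -conjCE; apply: geC0_conj; rewrite sqrtC_ge0.
rewrite -[X in _ = X * _]conjCE rmorphM /= !conjCE sq.
rewrite (bigD1 k) //= big1 ?addr0.
  rewrite !mxE eqxx mulr1n conjCE -{1}[d 0 k]sqrtCK; ring.
by move=> l lk; rewrite !mxE (negPf lk) mulr0n mulr0.
Qed.

End PosSemidef.

(** * Schur multipliers of finite matrices, and their passage to operators *)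

Section SchurMultipliers.
Variable G : cgroup.
Local Notation e := (gone G).
Implicit Types (f u v xi : G -> C) (s F : seq G) (T S x y : op G)
  (sigma : G -> G -> C) (A : G -> G -> C) (psi : G -> R).

(* The form is bilinear rather than sesquilinear: replacing [u] by its conjugate
   does not change [nrm s u], so [bil_le] is still the operator norm bound. *)
Definition bilin s A u v : C := \sum_(h <- s) \sum_(k <- s) A h k * (u h * v k).

Definition bil_le s A (M : R) :=
  forall u v, normc (bilin s A u v) <= M * (nrm s u * nrm s v).

Definition schur psi A : G -> G -> C :=
  fun h k => (psi (gmul h (ginv k)))%:C * A h k.

(** Testing on finite matrices only makes sums, products and uniform limits of multipliers purely
    algebraic; [ople_schur] returns to operators. *)
Definition mult_le psi (K : R) := forall s A M,
  0 <= M -> bil_le s A M -> bil_le s (schur psi A) (K * M).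

Lemma pos_def_factor (phi : G -> C) s : pos_def phi ->
  exists n (B : 'I_n -> G -> C), forall h k, h \in s -> k \in s ->
    phi (gmul h (ginv k)) = \sum_i conjc (B i h) * B i k.
Proof.
(* [pos_def] uses kernels [g_i^-1 g_j] while the matrices here involve [h k^-1], hence the inverses
   of the points of [s]. *)
move=> pphi; pose g (i : 'I_(size s)) := ginv (nth e s i).
pose P : 'M[C]_(size s) := \matrix_(i, j) phi (gmul (ginv (g i)) (g j)).
have [B BP] : exists B : 'M[C]_(size s),
    forall i j, P i j = \sum_k conjc (B k i) * B k j.
  apply: psd_factor => c; have := pphi _ g c.
  by under eq_bigr do under eq_bigr do rewrite -[phi _](mxE matrix_key
    (fun i j => phi (gmul (ginv (g i)) (g j)))).
have idx h : h \in s -> exists i : 'I_(size s), h = nth e s i.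
  by rewrite -index_mem => hs; exists (Ordinal hs); rewrite /= nth_index // -index_mem.
exists (size s), (fun i h => if insub (index h s) is Some j then B i j else 0).
move=> h k hs ks.
have hs' : (index h s < size s)%N by rewrite index_mem.
have ks' : (index k s < size s)%N by rewrite index_mem.
rewrite !insubT.
have := BP (Ordinal hs') (Ordinal ks'); rewrite mxE /g /= ginvK !nth_index //.
Qed.

(** Schur's argument: the factorisation moves the kernel out of the matrix into the vectors, leaving
    a sum of forms of [A] itself. *)
Lemma mult_le_pos_def psi : pos_def (fun g => (psi g)%:C) -> mult_le psi (psi e).
Proof.
move=> pd s A M M0 AM u v.
have [n [B BE]] := pos_def_factor s pd.
pose U i h := conjc (B i h) * u h; pose V i k := B i k * v k.
have -> : bilin s (schur psi A) u v = \sum_i bilin s A (U i) (V i).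
  rewrite /bilin [RHS]exchange_big /= big_seq [RHS]big_seq; apply: eq_bigr => h hs.
  rewrite [RHS]exchange_big /= big_seq [RHS]big_seq; apply: eq_bigr => k ks.
  rewrite /schur BE // !mulr_suml; apply: eq_bigr => i _; rewrite /U /V; ring.
have diag h : h \in s -> \sum_i normc (B i h) ^+ 2 = psi e.
  move=> hs; have := BE _ _ hs hs; rewrite gmulgV => /(congr1 (@complex.Re R)) /= ->.
  rewrite raddf_sum /=; apply: eq_bigr => i _.
  by rewrite mulrC mulc_conj.
have nU w (W : 'I_n -> G -> C) :
    (forall i h, normc (W i h) = normc (B i h) * normc (w h)) ->
    \sum_i nrm s (W i) ^+ 2 = psi e * nrm s w ^+ 2.
  move=> WE; under eq_bigr do rewrite sqr_nrm.
  rewrite exchange_big /= sqr_nrm mulr_sumr big_seq [RHS]big_seq.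
  apply: eq_bigr => h hs; under eq_bigr do rewrite WE exprMn.
  by rewrite -mulr_suml diag.
have psi0 : 0 <= psi e.
  have := pd 1%N (fun=> e) (fun=> 1).
  rewrite !big_ord1 gmulVg rmorph1 !mul1r.
  by rewrite ler0c.
apply: le_trans (normc_sum _ _ _) _.
(* The [i]-th form is that of [A] at [U i], [V i]; Cauchy-Schwarz over [i] then
   brings back [\sum_i normc (B i h) ^+ 2 = psi e]. *)
apply: le_trans (_ : \sum_i M * (nrm s (U i) * nrm s (V i)) <= _).
  by apply: ler_sum => i _; exact: AM.
rewrite -mulr_sumr [psi e * M]mulrC -mulrA ler_wpM2l //.
apply: le_trans (cauchy_schwarz_seq _ _ _) _; try by move=> i; exact: nrm_ge0.
rewrite (nU u) ?(nU v); first last.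
- by move=> i h; rewrite /U normcM normc_conj.
- by move=> i h; rewrite /V normcM.
rewrite sqrtrM // [Num.sqrt (psi e * nrm s v ^+ 2)]sqrtrM //.
rewrite !sqrtr_sqr !ger0_norm ?nrm_ge0 // mulrACA -expr2 sqr_sqrtr //.
Qed.

Lemma bilinD s A A' u v :
  bilin s (fun h k => A h k + A' h k) u v = bilin s A u v + bilin s A' u v.
Proof.
rewrite /bilin -big_split; apply: eq_bigr => h _ /=; rewrite -big_split /=.
by apply: eq_bigr => k _; rewrite mulrDl.
Qed.

Lemma bilinZ a s A u v : bilin s (fun h k => a * A h k) u v = a * bilin s A u v.
Proof.
rewrite /bilin mulr_sumr; apply: eq_bigr => h _; rewrite mulr_sumr.
by apply: eq_bigr => k _; rewrite -mulrA.
Qed.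

Lemma eq_bilin s A A' u v : (forall h k, A h k = A' h k) ->
  bilin s A u v = bilin s A' u v.
Proof. by move=> AA; do 2!(apply: eq_bigr => ? _); rewrite AA. Qed.

Lemma mult_le_weak psi K K' : K <= K' -> mult_le psi K -> mult_le psi K'.
Proof.
move=> KK pK s A M M0 AM u v; apply: le_trans (pK _ _ _ M0 AM u v) _.
by rewrite !ler_wpM2r // mulr_ge0 ?nrm_ge0.
Qed.

Lemma mult_le_eq psi psi' K : psi =1 psi' -> mult_le psi K -> mult_le psi' K.
Proof. by move=> /funext ->. Qed.

Lemma mult_leD psi psi' K K' : mult_le psi K -> mult_le psi' K' ->
  mult_le (fun g => psi g + psi' g) (K + K').
Proof.
move=> pK pK' s A M M0 AM u v.
rewrite (@eq_bilin _ _ (fun h k => schur psi A h k + schur psi' A h k)); last first.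
  by move=> h k; rewrite /schur rmorphD mulrDl.
rewrite bilinD !mulrDl; apply: le_trans (normcD _ _) _.
by rewrite lerD ?pK ?pK'.
Qed.

Lemma mult_leZ r psi K : 0 <= r -> mult_le psi K ->
  mult_le (fun g => r * psi g) (r * K).
Proof.
move=> r0 pK s A M M0 AM u v.
rewrite (@eq_bilin _ _ (fun h k => r%:C * schur psi A h k)); last first.
  by move=> h k; rewrite /schur rmorphM mulrA.
by rewrite bilinZ normcM normcR ger0_norm // -!mulrA ler_wpM2l // mulrA pK.
Qed.

Lemma mult_le0 : mult_le (fun=> 0) 0.
Proof.
move=> s A M M0 AM u v; rewrite (@eq_bilin _ _ (fun h k => 0 * A h k)).
  by rewrite bilinZ !mul0r (@normc0 R).
by move=> h k; rewrite /schur rmorph0.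
Qed.

Lemma mult_le_sum (I : Type) (r : seq I) (psi : I -> G -> R) (K : I -> R) :
  (forall i, mult_le (psi i) (K i)) ->
  mult_le (fun g => \sum_(i <- r) psi i g) (\sum_(i <- r) K i).
Proof.
move=> H; elim: r => [|i r IH].
  by rewrite big_nil; apply: mult_le_eq mult_le0 => g; rewrite big_nil.
rewrite big_cons; apply: mult_le_eq (mult_leD (H i) IH) => g.
by rewrite big_cons.
Qed.

Lemma mult_leM psi psi' K K' : 0 <= K' -> mult_le psi K -> mult_le psi' K' ->
  mult_le (fun g => psi g * psi' g) (K * K').
Proof.
move=> K0 pK pK' s A M M0 AM u v.
rewrite (@eq_bilin _ _ (schur psi (schur psi' A))); last first.
  by move=> h k; rewrite /schur rmorphM mulrA.
by rewrite -[K * _ * _]mulrA; apply: pK; [exact: mulr_ge0|exact: pK'].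
Qed.

Lemma mult_leX1 psi q : mult_le psi 1 -> mult_le (fun g => psi g ^+ q) 1.
Proof.
move=> p1; elim: q => [|q IH].
  by move=> s A M M0 AM u v; rewrite mul1r (@eq_bilin _ _ A) // => h k;
    rewrite /schur expr0 rmorph1 mul1r.
rewrite -[1]mulr1; apply: mult_le_eq (mult_leM ler01 p1 IH) => g.
by rewrite exprS.
Qed.

(** On a fixed finite [s], replacing [psi] by a uniformly [d]-close function changes the form by at
    most [d] times the sum [Z] of the moduli of its terms. *)
Lemma mult_le_lim psi K :
  (forall d : R, 0 < d -> exists2 psi', mult_le psi' K &
     forall g, `|psi g - psi' g| <= d) -> mult_le psi K.
Proof.
move=> H s A M M0 AM u v; apply/ler_addgt0Pl => d d0.
pose Z := \sum_(h <- s) \sum_(k <- s) normc (A h k * (u h * v k)).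
have Z0 : 0 < Z + 1.
  by rewrite ltr_wpDl // sumr_ge0 // => h _; rewrite sumr_ge0 // => k _; exact: normc_ge0.
have [psi' pK pp] := H _ (divr_gt0 d0 Z0).
rewrite (@eq_bilin _ _ (fun h k => schur psi' A h k +
  schur (fun g => psi g - psi' g) A h k)); last first.
  by move=> h k; rewrite /schur rmorphB mulrBl addrC subrK.
rewrite bilinD addrC; apply: le_trans (normcD _ _) _; apply: lerD; last exact: pK.
apply: le_trans (_ : d / (Z + 1) * Z <= _); last first.
  by rewrite mulrAC ler_pdivrMr // ler_pM2l // lerDl.
rewrite mulr_sumr; apply: le_trans (normc_sum _ _ _) _; apply: ler_sum => h _.
rewrite mulr_sumr; apply: le_trans (normc_sum _ _ _) _; apply: ler_sum => k _.
by rewrite /schur -mulrA normcM normcR ler_wpM2r ?normc_ge0.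
Qed.

Definition restr s f : G -> C := fun h => if h \in s then f h else 0.

Lemma l2le_restr s f : uniq s -> l2le (restr s f) (nrm s f).
Proof.
move=> us s' us'; rewrite nrm_le ?nrm_ge0 // sqr_nrm.
rewrite (bigID (mem s)) /= [X in _ + X]big1 ?addr0; last first.
  by move=> h /negPf hs; rewrite /restr hs (@normc0 R) expr0n.
rewrite -big_filter -!sqr_nrm ler_sqr ?nnegrE ?nrm_ge0 //.
apply: le_trans (_ : nrm [seq x <- s' | mem s x] f <= _).
  by apply: ler_nrm => h; rewrite mem_filter /restr => /andP[/= -> _].
by apply: nrm_sub; rewrite ?filter_uniq // => h; rewrite mem_filter => /andP[].
Qed.

Lemma lin_op_restr T s f h : lin_op T -> uniq s ->
  T (restr s f) h = \sum_(k <- s) f k * T (delta k) h.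
Proof.
move=> lT; elim: s => [_|a s IH /= /andP[/negPf nas us]].
  by rewrite big_nil -[RHS](congr1 (@^~ h) (lin_op0 lT)).
have -> : restr (a :: s) f = fun h => f a * delta a h + restr s f h.
  apply/funext => k; rewrite /restr /delta inE.
  by case: eqP => [->|_]; rewrite ?nas ?mulr1 ?mulr0 ?addr0 ?add0r.
rewrite lT; last first.
- exact: l2le_is_l2 (l2le_restr _ us).
- exact: l2le_is_l2 (l2le_delta _).
by rewrite big_cons IH.
Qed.

Lemma bilin_op T s u v : lin_op T -> uniq s ->
  bilin s (fun h k => T (delta k) h) u v = \sum_(h <- s) u h * T (restr s v) h.
Proof.
move=> lT us; apply: eq_bigr => h _; rewrite lin_op_restr // mulr_sumr.
by apply: eq_bigr => k _; ring.
Qed.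

Lemma bil_le_op T s M : lin_op T -> uniq s -> ople T M ->
  bil_le s (fun h k => T (delta k) h) M.
Proof.
move=> lT us TM u v; rewrite bilin_op //.
apply: le_trans (cauchy_schwarz_nrm _ _ _) _.
rewrite mulrCA ler_wpM2l ?nrm_ge0 //.
by apply: TM (us); exact: l2le_restr.
Qed.

(** Testing the form at the conjugate of [w = T (restr s v)] yields the square of the norm of [w],
    and one factor cancels. *)
Lemma nrm_restr_le T s v M : lin_op T -> uniq s ->
  bil_le s (fun h k => T (delta k) h) M -> nrm s (T (restr s v)) <= M * nrm s v.
Proof.
move=> lT us H; set w := T _.
have := H (fun h => conjc (w h)) v; rewrite bilin_op //.
have -> : nrm s (fun h => conjc (w h)) = nrm s w.
  by apply: eq_nrm => h _; exact: normc_conj.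
have -> : \sum_(h <- s) conjc (w h) * T (restr s v) h = (nrm s w ^+ 2)%:C.
  rewrite sqr_nrm rmorph_sum /=; apply: eq_bigr => h _.
  by rewrite mulrC mulc_conj.
rewrite normcR ger0_norm ?sqr_ge0 // mulrCA expr2 => H1.
have [w0|w0] := ltP 0 (nrm s w); first by rewrite ler_pM2l in H1.
have nw : nrm s w = 0 by apply/eqP; rewrite eq_le w0 nrm_ge0.
have [z0|z0] := ltP 0 (nrm s v).
  (* Here [w] vanishes on [s], and the bound at [(v, v)] supplies [0 <= M * nrm s v]. *)
  have := H (fun h => v h) v.
  move=> /(le_trans (normc_ge0 _)); rewrite nw.
  by rewrite mulrA pmulr_lge0.
have -> : nrm s v = 0 by apply/eqP; rewrite eq_le z0 nrm_ge0.
by rewrite nw mulr0.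
Qed.

(** If [s0] carries the squared norm up to [d ^+ 2], a list disjoint from [s0] can be appended to it
    without exceeding the supremum, so it carries at most [d ^+ 2]. *)
Lemma l2_tail f (d : R) : is_l2 f -> 0 < d ->
  exists s0, forall s, {subset s0 <= s} -> l2le (fun h => f h - restr s f h) d.
Proof.
move=> [M fM] d0.
set E := [set \sum_(g <- s) cabs2 (f g) | s in [set s : seq G | uniq s]]%classic.
have hE : has_sup E.
  split; first by exists (\sum_(g <- [::]) cabs2 (f g)), [::].
  by exists M => _ [s us <-]; exact: fM.
have [_ [s0 us0 <-] Hs0] := sup_adherent (exprn_gt0 2 d0) hE.
exists s0 => s ss s' us'; rewrite nrm_le ?ltW //.
rewrite (bigID (mem s)) /= big1 ?add0r; last first.
  by move=> h hs; rewrite /restr hs subrr (@normc0 R) expr0n.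
under eq_bigr => h /negPf hs do rewrite /restr hs subr0 -cabs2E.
rewrite -big_filter.
set l := [seq h <- s' | h \notin s].
have ul : uniq (l ++ s0).
  rewrite cat_uniq filter_uniq //= us0 andbT; apply/hasPn => h /ss hs.
  by rewrite mem_filter hs.
have /(ub_le_sup hE.2) : E (\sum_(h <- l ++ s0) cabs2 (f h)) by exists (l ++ s0).
rewrite big_cat /=.
move: Hs0; set a := sup _; set b := \sum_(_ <- s0) _; set c := \sum_(_ <- _) _.
lra.
Qed.

(** Entries determine [T'] on finitely supported vectors, where the finite matrix bound applies. The
    remaining tail of [f] is small in l^2, and boundedness of [T'] makes its image small. *)
Lemma ople_schur psi T T' : is_bounded_op T -> is_bounded_op T' ->
  mult_le psi 1 ->
  (forall h k, T' (delta k) h = (psi (gmul h (ginv k)))%:C * T (delta k) h) ->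
  ople T' (opnorm T).
Proof.
move=> bT bT' p1 TT f N fN s us; have lT := bounded_lin bT; have lT' := bounded_lin bT'.
apply/ler_addgt0Pl => d d0; have N0 := l2le_ge0 fN; have lf := l2le_is_l2 fN.
have o1 : 0 < opnorm T' + 1 by rewrite ltr_wpDl ?opnorm_ge0.
have [s0 Hs0] := l2_tail lf (divr_gt0 d0 o1).
pose s' := undup (s ++ s0).
have us' : uniq s' := undup_uniq _.
have ss' : {subset s <= s'} by move=> h hs; rewrite mem_undup mem_cat hs.
have /Hs0 ft : {subset s0 <= s'} by move=> h hs; rewrite mem_undup mem_cat hs orbT.
have -> : f = fun h => 1 * restr s' f h + (f h - restr s' f h).
  by apply/funext => h; rewrite mul1r addrC subrK.
rewrite lT'; last first.
- exact: l2le_is_l2 ft.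
- exact: l2le_is_l2 (l2le_restr _ us').
apply: le_trans (nrmD _ _ _) _; rewrite addrC; apply: lerD.
  apply: le_trans (ople_opnorm bT' ft us) _.
  by rewrite mulrCA ler_piMr ?(ltW d0) // ler_pdivrMr // mul1r lerDl.
rewrite nrmZ (@normc1 R) mul1r; apply: le_trans (nrm_sub _ us ss') _.
apply: le_trans (_ : opnorm T * nrm s' f <= _); last first.
  by rewrite ler_wpM2l ?opnorm_ge0 // fN.
apply: nrm_restr_le => // u v.
rewrite (@eq_bilin _ _ (schur psi (fun h k => T (delta k) h))) //.
rewrite -[X in X * _]mul1r; apply: p1; first exact: opnorm_ge0.
by apply: bil_le_op => //; exact: ople_opnorm.
Qed.

End SchurMultipliers.

(* Right Riemann sum, of step [1 / N], of [exp (- a s)] over [0 <= s <= N]. *)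
Definition exp_riemann (N : nat) (a : R) : R :=
  N%:R^-1 * \sum_(k < N ^ 2) expR (- (a / N%:R)) ^+ k.+1.

(** With [y = a / N], [x = exp (- y)] and [X = x ^+ (N ^ 2) = exp (- a N)], the geometric sum
    satisfies [(1 - x) S = x (1 - X)]. From [1 - y <= x <= 1 / (1 + y)] the product [y S] lies
    between [1 - y - X] and [1]. The error [2 / N] adds the step size and the truncation at [N]. *)
Lemma exp_riemann_bounds (N : nat) (a : R) : (0 < N)%N -> 1 <= a ->
  exp_riemann N a <= a^-1 /\ a^-1 - 2 / N%:R <= exp_riemann N a.
Proof.
move=> N0 a1; rewrite /exp_riemann; set n : R := N%:R.
have n1 : 1 <= n by rewrite ler1n.
set y := a / n; set x := expR _; set S := \sum_(_ < _) _.
have a0 : 0 < a by lra.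
have n0 : 0 < n by lra.
have ay : a = y * n by rewrite /y; field; lra.
have y0 : 0 < y by rewrite divr_gt0.
have x0 : 0 < x := expR_gt0 _.
have xy : 1 - y <= x by have := expR_ge1Dx (- y).
have xy1 : x * (1 + y) <= 1.
  by rewrite /x expRN mulrC ler_pdivrMr ?expR_gt0 // mul1r expR_ge1Dx.
set X := x ^+ (N ^ 2).
have X0 : 0 < X by rewrite exprn_gt0.
have Xn : X * (1 + a * n) <= 1.
  rewrite /X /x -expRM_natl natrX -/n.
  have -> : n ^+ 2 * - y = - (a * n) by rewrite ay; ring.
  by rewrite expRN mulrC ler_pdivrMr ?expR_gt0 // mul1r expR_ge1Dx.
have SE : (1 - x) * S = x * (1 - X).
  have := subrX1 x (N ^ 2); rewrite -/X => XE.
  rewrite -opprB -[1 - X]opprB XE mulrN mulNr mulrCA; congr (- (_ * _)).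
  by rewrite /S mulr_sumr; apply: eq_bigr => i _; rewrite exprS.
have S0 : 0 <= S by apply: sumr_ge0 => k _; rewrite exprn_ge0 // ltW.
have x1 : 0 < 1 - x by nra.
have X1 : X <= 1 by nra.
have vE : n^-1 * S = y * S / a by rewrite ay; field; lra.
rewrite vE; split.
  rewrite ler_pdivrMr // mulVf ?gt_eqF //.
  rewrite -(ler_pM2l x1); nra.
have yS : 1 - y - X <= y * S by nra.
apply: le_trans (_ : (1 - y - X) / a <= _); last by rewrite ler_pM2r ?invr_gt0.
have -> : (1 - y - X) / a = a^-1 - n^-1 - X / a by rewrite ay; field; lra.
have Xa : X / a <= n^-1.
  apply: le_trans (_ : X <= _); first by rewrite ler_pdivrMr // ler_peMr // ltW.
  rewrite -[n^-1]mul1r ler_pdivlMr //; nra.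
lra.
Qed.

(** * Multipliers attached to a Haagerup function *)

Section Semigroup.
Variables (G : cgroup) (L : G -> R).
Hypothesis HL : haagerup L.

Let L_ge0 g : 0 <= L g. Proof. by case: HL. Qed.

Lemma mult_le_exp (t : R) : 0 < t -> mult_le (fun g => expR (- (t * L g))) 1.
Proof.
move=> t0; have [_ nL _] := HL.
apply: mult_le_weak (mult_le_pos_def (nL _ t0)).
by rewrite -expR0 ler_expR oppr_le0 mulr_ge0 // ltW.
Qed.

Lemma mult_le_resolvent (t : R) : 0 < t -> mult_le (fun g => (1 + t * L g)^-1) 1.
Proof.
move=> t0; apply: mult_le_lim => d d0.
have [N Nd] : exists N : nat, 2 / (N.+1)%:R <= d.
  exists (Num.truncn (2 / d)).
  rewrite ler_pdivrMr // mulrC -ler_pdivrMr // ltW //; exact: truncnS_gt.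
exists (fun g => exp_riemann N.+1 (1 + t * L g)); last first.
  move=> g; have a1 : 1 <= 1 + t * L g by rewrite lerDl mulr_ge0 // ltW.
  have [h1 h2] := exp_riemann_bounds (ltn0Sn N) a1.
  by rewrite ger0_norm ?subr_ge0 //; apply: le_trans Nd; rewrite lerBlDl -lerBlDr.
(* Each term splits off the constant [exp (- (k + 1) / n)], the rest being a multiplier of norm at
   most 1. The constants add up to the Riemann sum at [a = 1], which is at most 1. *)
have [+ _] := exp_riemann_bounds (ltn0Sn N) (lexx 1).
rewrite invr1 => /mult_le_weak; apply; rewrite /exp_riemann.
apply: mult_leZ; first by rewrite invr_ge0.
apply: mult_le_sum => k; set n : R := (N.+1)%:R.
have n0 : 0 < n by rewrite ltr0n.
rewrite -[X in mult_le _ X]mulr1.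
have tk : 0 < k.+1%:R * t / n by rewrite divr_gt0 ?mulr_gt0.
apply: mult_le_eq (mult_leZ _ (mult_le_exp tk)); last by rewrite exprn_ge0 ?expR_ge0.
move=> g /=; rewrite -!expRM_natl -expRD; congr expR; field; lra.
Qed.

End Semigroup.

(** * Unconditional convergence of Fourier series *)

(** The limit is taken as the supremum of the eventual lower bounds of [u], that is, its lower
    limit. *)
Lemma real_cauchy_lim (u : nat -> R) :
  (forall d : R, 0 < d -> exists N, forall n m, (N <= n)%N -> (N <= m)%N ->
     `|u n - u m| <= d) ->
  exists l, forall d : R, 0 < d -> exists N, forall n, (N <= n)%N -> `|u n - l| <= d.
Proof.
move=> H; pose E := [set a : R | exists N, forall n, (N <= n)%N -> a <= u n]%classic.
exists (sup E) => d d0.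
have [N HN] := H _ (divr_gt0 d0 (ltr0Sn _ 1)); exists N => n Nn.
have lb : E (u N - d / 2).
  exists N => m Nm; have := HN N m (leqnn _) Nm; rewrite ler_norml => /andP[_].
  lra.
have ub : ubound E (u N + d / 2).
  move=> a [N' aN]; have := aN _ (leq_maxr N N').
  have := HN (maxn N N') N (leq_maxl _ _) (leqnn _); rewrite ler_norml => /andP[_].
  lra.
have h1 : u N - d / 2 <= sup E by apply: ub_le_sup => //; exists (u N + d / 2).
have h2 : sup E <= u N + d / 2 by apply: ge_sup => //; exists (u N - d / 2).
have := HN n N Nn (leqnn _); rewrite !ler_norml => /andP[h3 h4].
by apply/andP; split; lra.
Qed.

Definition clim (u : nat -> C) (l : C) := forall d : R, 0 < d ->
  exists N, forall n, (N <= n)%N -> normc (u n - l) <= d.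

Lemma clim_unique u l l' : clim u l -> clim u l' -> l = l'.
Proof.
move=> ul ul'; apply/eqP; rewrite -subr_eq0; apply/eqP; apply: normc_lim0 => d d0.
have d2 := divr_gt0 d0 (ltr0Sn _ 1).
have [N HN] := ul _ d2; have [N' HN'] := ul' _ d2.
have := HN _ (leq_maxl N N'); have := HN' _ (leq_maxr N N').
set z := u _ => h1 h2; have -> : l - l' = (z - l') - (z - l) by ring.
apply: le_trans (normcB _ _) _; lra.
Qed.

Lemma climD u v l l' : clim u l -> clim v l' -> clim (fun n => u n + v n) (l + l').
Proof.
move=> ul vl d d0; have d2 := divr_gt0 d0 (ltr0Sn _ 1).
have [N HN] := ul _ d2; have [N' HN'] := vl _ d2.
exists (maxn N N') => n; rewrite geq_max => /andP[/HN h1 /HN' h2].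
rewrite opprD addrACA; apply: le_trans (normcD _ _) _; lra.
Qed.

Lemma climZ a u l : clim u l -> clim (fun n => a * u n) (a * l).
Proof.
move=> ul d d0; have a0 : 0 < normc a + 1 by rewrite ltr_wpDl ?normc_ge0.
have [N HN] := ul _ (divr_gt0 d0 a0); exists N => n /HN h.
rewrite -mulrBr normcM; apply: le_trans (_ : normc a * (d / (normc a + 1)) <= _).
  by rewrite ler_wpM2l ?normc_ge0.
by rewrite mulrCA ler_piMr ?(ltW d0) // ler_pdivrMr // mul1r lerDl.
Qed.

Lemma Re_le_normc (z : C) : `|complex.Re z| <= normc z.
Proof. by case: z => a b /=; rewrite -sqrtr_sqr ler_wsqrtr // lerDl sqr_ge0. Qed.

Lemma Im_le_normc (z : C) : `|complex.Im z| <= normc z.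
Proof. by case: z => a b /=; rewrite -sqrtr_sqr ler_wsqrtr // lerDr sqr_ge0. Qed.

Lemma normc_le_ReIm (z : C) : normc z <= `|complex.Re z| + `|complex.Im z|.
Proof.
case: z => a b /=; rewrite -[leRHS]ger0_norm ?addr_ge0 // -sqrtr_sqr ler_wsqrtr //.
rewrite sqrrD !real_normK ?num_real // addrAC lerDl.
by rewrite mulrn_wge0 // mulr_ge0.
Qed.

Lemma cauchy_clim (u : nat -> C) :
  (forall d : R, 0 < d -> exists N, forall n m, (N <= n)%N -> (N <= m)%N ->
     normc (u n - u m) <= d) ->
  exists l, clim u l.
Proof.
move=> H.
have [a Ha] : exists a, forall d : R, 0 < d ->
    exists N, forall n, (N <= n)%N -> `|complex.Re (u n) - a| <= d.
  apply: real_cauchy_lim => d /H[N HN]; exists N => n m /HN{}HN /HN{}HN.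
  by apply: le_trans HN; rewrite -raddfB Re_le_normc.
have [b Hb] : exists b, forall d : R, 0 < d ->
    exists N, forall n, (N <= n)%N -> `|complex.Im (u n) - b| <= d.
  apply: real_cauchy_lim => d /H[N HN]; exists N => n m /HN{}HN /HN{}HN.
  by apply: le_trans HN; rewrite -raddfB Im_le_normc.
exists (a +i* b) => d d0; have d2 := divr_gt0 d0 (ltr0Sn _ 1).
have [N HN] := Ha _ d2; have [N' HN'] := Hb _ d2.
exists (maxn N N') => n; rewrite geq_max => /andP[/HN h1 /HN' h2].
apply: le_trans (normc_le_ReIm _) _.
by rewrite !raddfB /=; lra.
Qed.

(** * Norm bounds for twisted convolvers and convergence of their series *)

Section Convolvers.
Variable G : cgroup.
Implicit Types (f c b xi : G -> C) (s F : seq G) (T x y : op G)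
  (sigma : G -> G -> C) (psi L : G -> R).

(** Through this the Haagerup content, defined by untwisted convolvers, controls all twists at
    once. *)
Lemma pi_fs_domination sigma s c M : (forall g h, cabs2 (sigma g h) = 1) ->
  ople (pi_fs (@trivial_cocycle G) s (fun g => (normc (c g))%:C)) M ->
  ople (pi_fs sigma s c) M.
Proof.
move=> s1 H f N fN.
have /H : l2le (fun h => (normc (f h))%:C) N.
  by apply: l2le_mono fN => h; rewrite normcR ger0_norm ?normc_ge0.
apply: l2le_mono => h; rewrite /pi_fs /Lam /trivial_cocycle.
apply: le_trans (normc_sum _ _ _) _.
under [X in _ <= normc X]eq_bigr do rewrite mul1r -rmorphM.
rewrite -rmorph_sum normcR; apply: le_trans (ler_norm _).
by apply: ler_sum => g _; rewrite !normcM (normc_unit (s1 _ _)) mul1r.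
Qed.

Lemma trivial_cocycle_unit (g h : G) : cabs2 (trivial_cocycle g h) = 1.
Proof. by rewrite cabs2E (@normc1 R) expr1n. Qed.

(** Normalising [c] gives a competitor in the supremum defining the content. The list [s0] makes [P]
    finite, which keeps that supremum from its default value [0]. *)
Lemma ople_hcontent (P : G -> Prop) (s0 s : seq G) c (W : R) :
  (forall g, P g -> g \in s0) -> hcontent P <= W ->
  uniq s -> (forall g, g \in s -> P g) ->
  ople (pi_fs (@trivial_cocycle G) s c) (W * nrm s c).
Proof.
move=> Ps0 PW us sP.
have [n0|n0] := ltP 0 (nrm s c); last first.
  have n00 : nrm s c = 0 by apply/eqP; rewrite eq_le n0 nrm_ge0.
  move=> f N fN; rewrite n00 mulr0 mul0r.
  rewrite (_ : pi_fs _ _ _ _ = fun=> 0); first exact: l2le0.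
  apply/funext => h; rewrite /pi_fs big_seq big1 // => g gs.
  rewrite (_ : c g = 0) ?mul0r //; apply: eq0_normc; apply/eqP.
  by rewrite eq_le normc_ge0 andbT -n00 normc_le_nrm.
pose n := nrm s c; pose f g := (n^-1)%:C * restr s c g.
have nn : normc (n^-1)%:C = n^-1 by rewrite normcR ger0_norm // invr_ge0 ltW.
have f1 : l2norm f = 1.
  have lf : l2le f 1.
    apply: l2le_weak (l2leZ _ (l2le_restr c us)).
    by rewrite nn mulVf // gt_eqF.
  apply/eqP; rewrite eq_le l2norm_le //=.
  apply: le_trans (is_l2_le (l2le_is_l2 lf) us).
  rewrite nrmZ nn (_ : nrm s _ = n) ?mulVf // ?gt_eqF //.
  by apply: eq_nrm => g gs; rewrite /restr gs.
have fW : opnorm (pi_fs (@trivial_cocycle G) s f) <= W.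
  apply: le_trans PW; apply: ub_le_sup; last first.
    exists s, f; split => // g /negPf gs.
    by rewrite /f /restr gs mulr0.
  (* A unit vector has coefficients of modulus at most 1, and at most [size s0] of them lie in
     [P]. *)
  exists (size s0)%:R => _ [s' [f' [us' sP' f'0 f'1 ->]]].
  apply: opnorm_le => //; apply: ople_weak (ople_pi_fs_sum _ _ trivial_cocycle_unit).
  have lf' : is_l2 f'.
    rewrite (_ : f' = restr s' f'); first exact: l2le_is_l2 (l2le_restr _ us').
    by apply/funext => g; rewrite /restr; case: ifPn => // /f'0.
  apply: le_trans (_ : \sum_(g <- s') 1 <= _).
    rewrite big_seq [leRHS]big_seq; apply: ler_sum => g gs.
    rewrite -f'1; apply: le_trans (is_l2_le lf' us'); exact: normc_le_nrm.
  rewrite big_const_seq count_predT iter_addr_0 ler_nat.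
  by apply: uniq_leq_size => // g /sP' /Ps0.
have bf : is_bounded_op (pi_fs (@trivial_cocycle G) s f).
  by apply: bounded_pi_fs; exact: trivial_cocycle_unit.
move=> xi N xiN.
rewrite (_ : pi_fs _ s c xi =
  fun h => n%:C * pi_fs (@trivial_cocycle G) s f xi h).
  have /(l2leZ n%:C) := ople_weak fW (ople_opnorm bf) xiN.
  by rewrite normcR gtr0_norm // mulrA [n * W]mulrC.
apply/funext => h; rewrite /pi_fs mulr_sumr big_seq [RHS]big_seq.
apply: eq_bigr => g gs; rewrite /f /restr gs !mulrA -rmorphM mulfV ?mul1r //.
by rewrite gt_eqF.
Qed.

Lemma pi_fs_split sigma (P : pred G) s c f h :
  pi_fs sigma s c f h = pi_fs sigma [seq g <- s | P g] c f h +
                        pi_fs sigma [seq g <- s | ~~ P g] c f h.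
Proof. by rewrite /pi_fs (bigID P) !big_filter. Qed.

Lemma ople_split sigma (P : pred G) s c M N :
  ople (pi_fs sigma [seq g <- s | P g] c) M ->
  ople (pi_fs sigma [seq g <- s | ~~ P g] c) N ->
  ople (pi_fs sigma s c) (M + N).
Proof.
move=> PM PN f K fK; rewrite mulrDl.
rewrite (_ : pi_fs sigma s c f = fun h => pi_fs sigma [seq g <- s | P g] c f h +
                        pi_fs sigma [seq g <- s | ~~ P g] c f h).
  by apply: l2leD; [exact: PM|exact: PN].
by apply/funext => h; exact: pi_fs_split.
Qed.

Lemma ople_pi_fs_nil sigma c : ople (pi_fs sigma [::] c) 0.
Proof.
move=> f N fN; rewrite mul0r (_ : pi_fs _ _ _ _ = fun=> 0); first exact: l2le0.
by apply/funext => h; rewrite /pi_fs big_nil.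
Qed.

Lemma hcontent_ge0 (P : G -> Prop) : 0 <= hcontent P.
Proof. by apply: sup_ge0 => _ [s [f [_ _ _ _ ->]]]; exact: opnorm_ge0. Qed.

Section Shells.
Variables (L psi : G -> R) (m : nat -> R) (sigma : G -> G -> C).
Hypothesis s1 : forall g h, cabs2 (sigma g h) = 1.
Local Notation W n := (hcontent (ball L n.+1%:R)).
Hypothesis proper : forall t : R, exists s : seq G, forall g, L g <= t -> g \in s.
Hypothesis m0 : forall n, 0 <= m n.
Hypothesis psim : forall n g, n%:R <= L g -> `|psi g| <= m n.
Hypothesis Wm : forall d : R, 0 < d -> exists n0, forall N,
  \sum_(n0 <= n < n0 + N) W n * m n <= d.

(** The shell [n <= L < n + 1] lies in the ball of radius [n + 1], hence the shifted index in
    [W]. *)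
Lemma ople_shell b A n s : l2le b A -> uniq s ->
  (forall g, g \in s -> n%:R <= L g < n.+1%:R) ->
  ople (pi_fs sigma s (fun g => (psi g)%:C * b g)) (W n * m n * A).
Proof.
move=> bA us sL; apply: pi_fs_domination => //.
have [s0 s0P] := proper n.+1%:R.
apply: ople_weak (ople_hcontent _ s0P (lexx _) us _); last first.
  by move=> g /sL /andP[_ /ltW].
rewrite -mulrA ler_wpM2l ?hcontent_ge0 //.
apply: le_trans (_ : m n * nrm s b <= _); last first.
  by rewrite ler_wpM2l // bA.
have -> : m n * nrm s b = nrm s (fun g => (m n)%:C * b g).
  by rewrite nrmZ normcR ger0_norm.
apply: ler_nrm => g /sL /andP[/psim gm _].
by rewrite normcR ger0_norm ?normc_ge0 // !normcM !normcR ler_wpM2r ?normc_ge0 //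
  (ger0_norm (m0 _)).
Qed.

Lemma ople_shells b A n0 N s : l2le b A -> uniq s ->
  (forall g, g \in s -> n0%:R <= L g < (n0 + N)%:R) ->
  ople (pi_fs sigma s (fun g => (psi g)%:C * b g))
    ((\sum_(n0 <= n < n0 + N) W n * m n) * A).
Proof.
move=> bA; elim: N s => [|N IH] s us sL.
  case: s us sL => [|g s] us sL.
    by rewrite addn0 big_geq // mul0r; exact: ople_pi_fs_nil.
  by have := sL g (mem_head _ _); rewrite addn0 ltNge => /andP[->].
rewrite addnS big_nat_recr ?leq_addr //= mulrDl.
apply: (ople_split (P := fun g => L g < (n0 + N)%:R)).
  apply: IH; rewrite ?filter_uniq // => g; rewrite mem_filter.
  by case/andP => -> /sL /andP[->].
apply: ople_shell; rewrite ?filter_uniq // => g; rewrite mem_filter -leNgt.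
by case/andP => -> /sL /andP[_]; rewrite addnS.
Qed.

(** The Cauchy criterion for unconditional convergence in operator norm. *)
Definition unif_tail sigma b := forall d : R, 0 < d -> exists F0 : seq G,
  forall s, uniq s -> (forall g, g \in s -> g \notin F0) -> ople (pi_fs sigma s b) d.

Lemma unif_tail_shells b : is_l2 b -> unif_tail sigma (fun g => (psi g)%:C * b g).
Proof.
move=> /is_l2_le; set A := l2norm b => bA d d0.
have A0 : 0 < A + 1 by rewrite ltr_wpDl ?l2norm_ge0.
have [n0 Hn0] := Wm (divr_gt0 d0 A0); have [F0 HF0] := proper n0%:R.
exists F0 => s us sF.
(* [F0] contains the ball of radius [n0], so [s] starts at shell [n0]; being finite, it meets
   finitely many shells. *)
have [N HN] : exists N, forall g, g \in s -> L g < (n0 + N)%:R.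
  elim: s {us sF} => [|g s [N HN]]; first by exists 0%N.
  exists (maxn N (Num.truncn (L g)).+1) => h; rewrite inE => /orP[/eqP ->|/HN hN].
    apply: lt_le_trans (truncnS_gt _) _; rewrite ler_nat.
    by apply: leq_trans (leq_maxr _ _) (leq_addl _ _).
  by apply: lt_le_trans hN _; rewrite ler_nat leq_add2l leq_maxl.
apply: ople_weak (ople_shells (n0 := n0) (N := N) bA us _).
  apply: le_trans (_ : d / (A + 1) * A <= _).
    by rewrite ler_wpM2r ?l2norm_ge0.
  by rewrite mulrAC ler_pdivrMr // ler_pM2l // lerDl.
move=> g gs; rewrite HN // andbT leNgt; apply/negP => /ltW /HF0 gF.
by have := sF g gs; rewrite gF.
Qed.

End Shells.

(** * The sum of an unconditionally convergent series of convolvers *)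

Section Limit.
Variables (sigma : G -> G -> C) (b : G -> C).
Hypothesis s1 : forall g h, cabs2 (sigma g h) = 1.
Hypothesis tail : unif_tail sigma b.

(** The common part of [F] and [F'] cancels, and what remains on either side avoids [F0]. *)
Lemma unif_tail_cauchy (d : R) : 0 < d -> exists F0 : seq G, forall F F',
  uniq F -> uniq F' -> {subset F0 <= F} -> {subset F0 <= F'} ->
  ople (opsub (pi_fs sigma F b) (pi_fs sigma F' b)) d.
Proof.
move=> d0; have [F0 HF] := tail (divr_gt0 d0 (ltr0Sn _ 1)).
exists F0 => F F' uF uF' sF sF'.
pose D := [seq g <- F | g \notin F']; pose D' := [seq g <- F' | g \notin F].
have HD : ople (pi_fs sigma D b) (d / 2).
  apply: HF; first by rewrite filter_uniq.
  by move=> g; rewrite mem_filter => /andP[gF' _]; apply: contra gF' => /sF'.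
have HD' : ople (pi_fs sigma D' b) (d / 2).
  apply: HF; first by rewrite filter_uniq.
  by move=> g; rewrite mem_filter => /andP[gF _]; apply: contra gF => /sF.
have -> : opsub (pi_fs sigma F b) (pi_fs sigma F' b) =
          opsub (pi_fs sigma D b) (pi_fs sigma D' b).
  apply/funext => f; apply/funext => h; rewrite /opsub.
  rewrite (pi_fs_split sigma (mem F') F) (pi_fs_split sigma (mem F) F').
  rewrite (_ : pi_fs sigma [seq g <- F | mem F' g] b f h =
               pi_fs sigma [seq g <- F' | mem F g] b f h).
    by rewrite opprD addrACA subrr add0r.
  apply: perm_big; apply: uniq_perm; rewrite ?filter_uniq // => g.
  by rewrite !mem_filter andbC.
by rewrite [d]splitr; exact: ople_sub.
Qed.

Definition enumG N : seq G := pmap pickle_inv (iota 0 N).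

Lemma enumG_uniq N : uniq (enumG N).
Proof. exact: (pmap_uniq (@pickle_invK _)) (iota_uniq _ _). Qed.

Lemma enumG_sub F0 : exists N, forall n, (N <= n)%N -> {subset F0 <= enumG n}.
Proof.
have H g N : (pickle g < N)%N -> g \in enumG N.
  move=> gN; rewrite mem_pmap; apply/mapP; exists (pickle g).
    by rewrite mem_iota.
  by rewrite pickleK_inv.
elim: F0 => [|g F0 [N HN]]; first by exists 0%N.
exists (maxn N (pickle g).+1) => n; rewrite geq_max => /andP[Nn gn] h.
by rewrite inE => /orP[/eqP->|/(HN _ Nn)//]; exact: H.
Qed.

(* The enumeration [enumG] is a cofinal sequence among the finite subsets of [G],
   so the limit along it is the limit of the net. *)
Definition lim_op : op G := fun f h =>
  xget 0 [set l | clim (fun N => pi_fs sigma (enumG N) b f h) l]%classic.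

Lemma lim_opP f h : is_l2 f ->
  clim (fun N => pi_fs sigma (enumG N) b f h) (lim_op f h).
Proof.
move=> lf; rewrite /lim_op; apply: xgetPex; apply: cauchy_clim => d d0.
have f0 : 0 < l2norm f + 1 by rewrite ltr_wpDl ?l2norm_ge0.
have [F0 HF] := unif_tail_cauchy (divr_gt0 d0 f0).
have [N HN] := enumG_sub F0; exists N => n m' /HN nF /HN mF.
have := HF _ _ (enumG_uniq n) (enumG_uniq m') nF mF _ _ (is_l2_le lf).
move=> /(_ [:: h] erefl) H.
have /le_trans := le_trans (normc_le_nrm _ (mem_head h [::])) H; apply.
by rewrite mulrAC ler_pdivrMr // ler_pM2l // lerDl.
Qed.

Lemma lin_lim_op : lin_op lim_op.
Proof.
move=> a f u lf lu; apply/funext => h.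
have lau : is_l2 (fun h => a * f h + u h).
  by apply: l2le_is_l2 (l2leD (l2leZ a (is_l2_le lf)) (is_l2_le lu)).
apply: (clim_unique (lim_opP h lau)).
have := climD (climZ a (lim_opP h lf)) (lim_opP h lu).
congr clim; apply/funext => N.
by rewrite (lin_pi_fs sigma (enumG N) b a lf lu).
Qed.

(** The Cauchy estimate is uniform in the vector, so [l2le_lim] upgrades the pointwise limit to a
    limit in operator norm. *)
Lemma lim_op_approx (d : R) : 0 < d -> exists F0 : seq G, forall F,
  uniq F -> {subset F0 <= F} -> ople (opsub lim_op (pi_fs sigma F b)) d.
Proof.
move=> d0; have [F0 HF] := unif_tail_cauchy d0; exists F0 => F uF sF f K fK.
apply: l2le_lim => s d' d'0.
have [N HN] := enumG_sub F0.
have [N' HN'] : exists N', forall n, (N' <= n)%N -> forall h, h \in s ->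
    normc (pi_fs sigma (enumG n) b f h - lim_op f h) <= d'.
  elim: s => [|g s [N1 H1]]; first by exists 0%N.
  have [N2 H2] := lim_opP g (l2le_is_l2 fK) d'0.
  exists (maxn N1 N2) => n; rewrite geq_max => /andP[n1 n2] h.
  by rewrite inE => /orP[/eqP->|]; [exact: H2|exact: H1].
pose n := maxn N N'.
exists (opsub (pi_fs sigma (enumG n) b) (pi_fs sigma F b) f).
  apply: HF => //; first exact: enumG_uniq.
  by apply: HN; exact: leq_maxl.
move=> h /(HN' n (leq_maxr _ _)); rewrite normcBC /opsub.
by rewrite opprB addrA subrK.
Qed.

(** The limit is within distance 1 of a finite sum, which is bounded. *)
Lemma bounded_lim_op : is_bounded_op lim_op.
Proof.
have [F0 HF] := lim_op_approx ltr01.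
have /HF H : {subset F0 <= undup F0} by move=> g; rewrite mem_undup.
have {}H := H (undup_uniq _).
pose c := \sum_(g <- undup F0) normc (b g).
apply: (@ople_bounded _ _ (1 + c) lin_lim_op) => f K fK.
have := l2leD (H _ _ fK) (ople_pi_fs_sum (undup F0) b s1 fK).
rewrite -mulrDl; apply: l2le_mono => h.
by rewrite /opsub subrK.
Qed.

End Limit.

Lemma xhat_l2 x : is_bounded_op x -> is_l2 (xhat x).
Proof. by move=> [x2 _ _]; apply: x2; exact: l2le_is_l2 (l2le_delta _). Qed.

Lemma MRel_exists sigma (phi : G -> C) x : cocycle sigma ->
  unif_tail sigma (fun g => phi g * xhat x g) -> exists y, MRel sigma phi x y.
Proof.
move=> [s1 _ _] tail; exists (lim_op sigma (fun g => phi g * xhat x g)).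
split; first exact: bounded_lim_op.
move=> d d0; have [F0 HF] := lim_op_approx tail (divr_gt0 d0 (ltr0Sn _ 1)).
exists F0 => F uF sF; apply: le_lt_trans (opnorm_le _ (HF F uF sF)) _.
  by rewrite divr_ge0 // ltW.
by rewrite ltr_pdivrMr // ltr_pMr // ltr1n.
Qed.

End Convolvers.

(** * Summing nets *)

Section Criterion.
Variables (G : cgroup) (sigma : G -> G -> C) (D : R -> Prop) (a : R)
  (Psi : R -> G -> R).
Hypothesis cs : cocycle sigma.
Hypothesis Psi_mult : forall t, D t -> mult_le (Psi t) 1.
Hypothesis Psi_tail : forall t, D t -> forall b, is_l2 b ->
  unif_tail sigma (fun g => (Psi t g)%:C * b g).
Hypothesis Psi_cvg : forall g (d : R), 0 < d -> exists2 delta : R, 0 < delta &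
  forall t, D t -> `|t - a| < delta -> `|Psi t g - 1| <= d.

Let s1 : forall g h, cabs2 (sigma g h) = 1. Proof. by case: cs. Qed.

Lemma Psi_cvg_sum (s : seq G) (c : G -> C) (d : R) : 0 < d ->
  exists2 delta : R, 0 < delta & forall t, D t -> `|t - a| < delta ->
    \sum_(g <- s) normc ((Psi t g - 1)%:C * c g) <= d.
Proof.
elim: s d => [|g s IH] d d0.
  by exists 1 => // t _ _; rewrite big_nil ltW.
have d2 := divr_gt0 d0 (ltr0Sn _ 1).
have [e1 e10 H1] := IH _ d2.
have c0 : 0 < normc (c g) + 1 by rewrite ltr_wpDl ?normc_ge0.
have [e2 e20 H2] := Psi_cvg g (divr_gt0 d2 c0).
exists (Num.min e1 e2); first by rewrite lt_min e10 e20.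
move=> t Dt; rewrite lt_min => /andP[/(H1 t Dt) h1 /(H2 t Dt) h2].
rewrite big_cons [leRHS]splitr lerD // normcM normcR.
apply: le_trans (_ : d / 2 / (normc (c g) + 1) * normc (c g) <= _).
  by rewrite ler_wpM2r ?normc_ge0.
by rewrite mulrAC ler_pdivrMr // ler_pM2l // lerDl.
Qed.

(** [ople_schur] gives the uniform bound 1. Convergence then follows by approximating [x] within
    [eps / 4] by a finite sum [z], on which the multipliers converge coefficientwise. *)
Lemma bounded_FSN_criterion : bounded_FSN sigma D a (fun t g => (Psi t g)%:C).
Proof.
split.
- move=> t Dt x [bx xC]; apply: MRel_exists => //; apply: Psi_tail => //.
  exact: xhat_l2.
- move=> x xC eps e0; have [bx xa] := xC.
  have e4 : 0 < eps / 4 by rewrite divr_gt0.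
  have [s [c xs]] := xa _ e4; have [delta delta0 Hd] := Psi_cvg_sum s c e4.
  exists delta => // t Dt td y yM; have by_ := yM.1.
  set z := pi_fs sigma s c in xs *.
  have bz : is_bounded_op z by exact: bounded_pi_fs.
  pose Mz := pi_fs sigma s (fun g => (Psi t g)%:C * c g).
  have bMz : is_bounded_op Mz by exact: bounded_pi_fs.
  pose w := pi_fs sigma s (fun g => (Psi t g - 1)%:C * c g).
  have h1 : ople (opsub y Mz) (opnorm (opsub x z)).
    apply: (@ople_schur _ (Psi t)) => //; try exact: bounded_sub.
      exact: Psi_mult.
    move=> h k; rewrite /opsub (MRel_entry h k cs xC yM) /Mz /z !pi_fs_delta.
    set g := gmul h (ginv k); rewrite mulrBr; congr (_ - _).
    rewrite mulrA; congr (_ * _); rewrite mulr_sumr.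
    by apply: eq_bigr => l /eqP ->.
  have h2 : ople w (eps / 4) by apply: ople_weak (ople_pi_fs_sum _ _ s1); exact: Hd.
  have h3 : ople (opsub x z) (opnorm (opsub x z)) := ople_opnorm (bounded_sub bx bz).
  (* [Mz] is the multiplier applied to [z], so [y - Mz] is the multiplier
     applied to [x - z]. *)
  have E : opsub y x = fun f h => (opsub y Mz f h + w f h) - opsub x z f h.
    apply/funext => f; apply/funext => h.
    have -> : w f h = Mz f h - z f h.
      rewrite /w /Mz /z /pi_fs -sumrB; apply: eq_bigr => g _.
      rewrite rmorphB rmorph1; ring.
    by rewrite /opsub; ring.
  apply: le_lt_trans (_ : opnorm (opsub x z) + eps / 4 + opnorm (opsub x z) < _);
    last lra.
  apply: opnorm_le; first by have := opnorm_ge0 (opsub x z); lra.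
  rewrite E => f N fN; rewrite !mulrDl.
  by apply: l2leB (h3 _ _ fN); apply: l2leD; [exact: h1|exact: h2].
- exists 1 => t Dt x xC y yM; rewrite mul1r.
  have [bx _] := xC; have [by_ _] := yM.
  apply: opnorm_le (opnorm_ge0 _) _.
  apply: (@ople_schur _ (Psi t)) => //; first exact: Psi_mult.
  by move=> h k; rewrite (MRel_entry h k cs xC yM).
Qed.

End Criterion.

(** * Scalar estimates and the two growth hypotheses *)

(** Summability test for both growth cases: the sum from [n0] on telescopes to at most [v n0]. *)
Lemma telescoping_tail (w v : nat -> R) (n1 : nat) :
  (forall n, (n1 <= n)%N -> w n <= v n - v n.+1) -> (forall n, 0 <= v n) ->
  (forall d, 0 < d -> exists2 n, (n1 <= n)%N & v n <= d) ->
  forall d, 0 < d -> exists n0, forall N, \sum_(n0 <= n < n0 + N) w n <= d.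
Proof.
move=> wv v0 vd d /vd[n0 n10 vn0]; exists n0 => N.
apply: le_trans (_ : v n0 - v (n0 + N)%N <= _); last first.
  by apply: le_trans vn0; rewrite lerBlDr lerDl.
elim: N => [|N IH]; first by rewrite addn0 big_geq // subrr.
rewrite addnS big_nat_recr ?leq_addr //=.
have := wv (n0 + N)%N (leq_trans n10 (leq_addr _ _)); lra.
Qed.

Lemma exprn_eventually_le (K : realType) (x d : K) : 0 < x < 1 -> 0 < d ->
  exists N, forall n, (N <= n)%N -> x ^+ n <= d.
Proof.
move=> /andP[x0 x1] d0.
have /cvgrPdist_le/(_ _ d0) : (x ^+ n @[n --> \oo] --> (0 : K))%classic.
  by apply: cvg_expr; rewrite gtr0_norm.
case=> N _ HN; exists N => n /HN /=.
by rewrite sub0r normrN gtr0_norm // exprn_gt0.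
Qed.

(** Bernoulli's inequality; it carries the convergence of the resolvent over to its powers. *)
Lemma onem_exprn_le (x : R) q : 0 <= x <= 1 -> 1 - x ^+ q <= q%:R * (1 - x).
Proof.
move=> /andP[x0 x1]; elim: q => [|q IH]; first by rewrite expr0 subrr mul0r.
rewrite exprS -natr1.
have xq : x ^+ q <= 1 by rewrite exprn_ile1.
have xq0 : 0 <= x ^+ q by rewrite exprn_ge0.
nra.
Qed.

Theorem theorem5p9 (G : cgroup) (L : G -> R) (HL : haagerup L) :
  (poly_Hgrowth L ->
     exists q : nat, (0 < q)%N /\
       forall sigma : G -> G -> C, cocycle sigma ->
         bounded_FSN sigma (fun t => 0 < t) 0
           (fun t g => ((1 + t * L g) ^- q)%:C))
  /\
  (subexp_Hgrowth L ->
     forall sigma : G -> G -> C, cocycle sigma ->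
       bounded_FSN sigma (fun r => 0 < r < 1) 1
         (fun r g => (r `^ L g)%:C)).
Proof.
have [L0 nL proper] := HL; split.
- move=> [K [p [K0 p0 growth]]].
  have [P pP] : exists P : nat, p <= P%:R.
    by exists (Num.truncn p).+1; rewrite ltW // truncnS_gt.
  (* The exponent leaves [n ^ P * n ^ (- q) = n ^ (-2)], which is summable. *)
  pose q := P.+2.
  exists q; split=> // sigma cs.
  have a1 (t : R) g : 0 < t -> 1 <= 1 + t * L g.
    by move=> t0; rewrite lerDl mulr_ge0 // ltW.
  apply: (@bounded_FSN_criterion _ sigma _ _ (fun t g => (1 + t * L g) ^- q)) => //.
  + move=> t t0; apply: mult_le_eq (mult_leX1 q (mult_le_resolvent HL t0)) => g.
    by rewrite exprVn.
  + have [s1 _ _] := cs; move=> t t0 b lb.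
    have t1 n : 0 < 1 + t * n%:R by rewrite ltr_pwDl // mulr_ge0 // ltW.
    apply: (@unif_tail_shells _ L _ (fun n => (1 + t * n%:R) ^- q)) => //.
    * by move=> n; rewrite invr_ge0 exprn_ge0 // ltW.
    * move=> n g ng; have g1 : 0 < 1 + t * L g := lt_le_trans ltr01 (a1 t g t0).
      rewrite ger0_norm ?invr_ge0 ?exprn_ge0 ?(ltW g1) //.
      rewrite lef_pV2 ?posrE ?exprn_gt0 //.
      apply: lerXn2r; [by rewrite nnegrE ltW|by rewrite nnegrE ltW|].
      by rewrite lerD2l ler_wpM2l // ltW.
    (* Chosen so that [tau * (n + 2) <= 1 + t * n]: twice [tau] is at most 1, and [tau] is at most
       [t]. *)
    pose tau := Num.min 1 t / 2.
    have mt0 : 0 < Num.min 1 t by rewrite lt_min ltr01 t0.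
    have tau0 : 0 < tau by rewrite divr_gt0.
    pose c := K * tau ^- q.
    have c0 : 0 < c by rewrite mulr_gt0 // invr_gt0 exprn_gt0.
    (* With [x = n + 2] the terms are at most [c / x ^+ 2], below [c / ((x - 1) * x)], the
       difference of consecutive values of [c / (n + 1)]. *)
    apply: (@telescoping_tail _ (fun n => c / n.+1%:R) 0%N).
    * move=> n _ /=; set x : R := n.+2%:R.
      have x2 : 2 <= x by rewrite ler_nat.
      have nE : n%:R = x - 2 :> R by rewrite /x -(addn2 n) natrD addrK.
      have n1E : n.+1%:R = x - 1 :> R by rewrite /x -(addn1 n.+1) natrD addrK.
      clearbody x.
      have h1 : hcontent (ball L n.+1%:R) <= K * x ^+ P.
        apply: le_trans (growth _ (ler0n _ _)) _; rewrite ler_wpM2l ?(ltW K0) //.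
        rewrite n1E (addrC 1) subrK -powR_mulrn; last lra.
        by apply: ler_powR => //; lra.
      have h2 : (1 + t * n%:R) ^- q <= (tau * x) ^- q.
        have taux0 : 0 < tau * x by rewrite mulr_gt0 //; lra.
        rewrite lef_pV2 ?posrE ?exprn_gt0 //.
        apply: lerXn2r; [by rewrite nnegrE ltW|by rewrite nnegrE ltW|].
        have m1 : Num.min 1 t <= 1 by rewrite ge_min lexx.
        have m2 : Num.min 1 t <= t by rewrite ge_min lexx orbT.
        have x20 : 0 <= x - 2 by lra.
        have h1' := ler_wpM2r x20 m2; have h2' := mulr_ge0 (ltW mt0) x20.
        rewrite nE /tau; move: m1 h1' h2'; set mm := Num.min 1 t; clearbody mm.
        clear; lra.
      apply: le_trans (ler_pM (hcontent_ge0 _) _ h1 h2) _.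
        by rewrite invr_ge0 exprn_ge0 // ltW.
      have x0 : x != 0 by lra.
      have -> : K * x ^+ P * (tau * x) ^- q = c * (x ^- 2).
        rewrite /c /q exprMn -addn2 !exprD; field.
        by rewrite x0 !expf_neq0 // gt_eqF.
      have -> : c / n.+1%:R - c / x = c * (((x - 1) * x)^-1).
        by rewrite n1E; field; rewrite x0; lra.
      rewrite ler_pM2l // lef_pV2 ?posrE; [|nra|nra].
      nra.
    * by move=> n; rewrite divr_ge0 // ltW.
    * move=> d d0; exists (Num.truncn (c / d)) => //.
      by rewrite ler_pdivrMr // mulrC -ler_pdivrMr // ltW // truncnS_gt.
  + move=> g d d0.
    have c0 : 0 < q%:R * L g + 1 by rewrite ltr_wpDl // mulr_ge0.
    (* The deviation from 1 is at most [q * t * L g]; the added 1 keeps the divisor positive when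
       [L g = 0]. *)
    exists (d / (q%:R * L g + 1)); first by rewrite divr_gt0.
    move=> t t0; rewrite subr0 gtr0_norm // => td.
    set u := 1 + t * L g; have u1 : 1 <= u := a1 t g t0.
    have u0 : 0 < u by lra.
    have uV1 : u^-1 <= 1 by rewrite invf_le1.
    have uV0 : 0 <= u^-1 by rewrite invr_ge0 ltW.
    have h : 1 - u^-1 <= t * L g.
      have -> : 1 - u^-1 = (t * L g) / u.
        have uE : t * L g = u - 1 by rewrite /u; ring.
        by rewrite uE; field; lra.
      by rewrite ler_piMr // mulr_ge0 // ltW.
    rewrite -exprVn distrC ger0_norm ?subr_ge0 ?exprn_ile1 //.
    apply: le_trans (onem_exprn_le q _) _; first by rewrite uV0.
    apply: le_trans (_ : t * (q%:R * L g + 1) <= _); last first.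
      by rewrite -ler_pdivlMr // ltW.
    apply: le_trans (_ : q%:R * (t * L g) <= _); first by rewrite ler_wpM2l.
    by rewrite mulrCA ler_pM2l // lerDl.
- move=> growth sigma cs.
  apply: (@bounded_FSN_criterion _ sigma _ _ (fun r g => r `^ L g)) => //.
  + move=> r /andP[r0 r1].
    (* [r ^ L] is the semigroup [exp (- t L)] at time [t = - ln r]. *)
    have lr : 0 < - ln r by rewrite oppr_gt0 ln_lt0 // r0.
    apply: mult_le_eq (mult_le_exp HL lr) => g.
    by rewrite /powR gt_eqF // mulNr opprK mulrC.
  + have [s1 _ _] := cs; move=> r /andP[r0 r1] b lb.
    apply: (@unif_tail_shells _ L _ (fun n => r ^+ n)) => //.
    * by move=> n; rewrite exprn_ge0 // ltW.
    * move=> n g ng; rewrite ger0_norm ?powR_ge0 // -powR_mulrn ?(ltW r0) //.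
      by apply: ger_powR => //; rewrite r0 ltW.
    (* With [b = r ^ (-1/2)] the growth bound leaves a geometric series of
       ratio [r ^ (1/2)]. *)
    pose rho := Num.sqrt r.
    have rho0 : 0 < rho by rewrite sqrtr_gt0.
    have rhoE : r = rho ^+ 2 by rewrite sqr_sqrtr // ltW.
    have rho1 : rho < 1 by rewrite -sqrtr1 ltr_sqrt.
    have rhoV1 : 1 < rho^-1 by rewrite invf_gt1.
    have [r1' Hr] := growth _ rhoV1.
    (* Solves [c * rho ^+ n - c * rho ^+ n.+1 = rho^-1 ^+ n.+1 * r ^+ n], using [r = rho ^+ 2]. *)
    pose c := rho^-1 / (1 - rho).
    have c0 : 0 < c by rewrite divr_gt0 ?invr_gt0 // subr_gt0.
    have rn0 n : 0 < rho ^+ n by rewrite exprn_gt0.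
    apply: (@telescoping_tail _ (fun n => c * rho ^+ n) (Num.truncn r1').+1).
    * move=> n nr.
      have /Hr : r1' <= n.+1%:R.
        by apply: le_trans (ltW (truncnS_gt _)) _; rewrite ler_nat leqW.
      rewrite powR_mulrn ?invr_ge0 ?(ltW rho0) // => /ltW h.
      apply: le_trans (_ : rho^-1 ^+ n.+1 * r ^+ n <= _).
        by rewrite ler_wpM2r // exprn_ge0 // ltW.
      rewrite le_eqVlt; apply/orP; left; apply/eqP.
      rewrite rhoE -exprM mulnC muln2 -addnn exprD exprVn exprS /c.
      by field; rewrite subr_eq0 !gt_eqF // rn0.
    * by move=> n; rewrite mulr_ge0 // ltW.
    * move=> d d0.
      have [|N HN] := @exprn_eventually_le R rho _ _ (divr_gt0 d0 c0).
        by rewrite rho0.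
      exists (maxn (Num.truncn r1').+1 N); first exact: leq_maxl.
      by rewrite mulrC -ler_pdivlMr // HN // leq_maxr.
  + move=> g d d0.
    have c0 : 0 < 2 * L g + 1 by rewrite ltr_wpDl // mulr_ge0.
    (* The bound [1 / 2] forces [r > 1 / 2], whence [r^-1 - 1 <= 2 * (1 - r)]. Then [1 - r ^ L <= -
       L ln r <= L (r^-1 - 1) <= 2 L (1 - r)], which the second bound keeps below [d]. *)
    exists (Num.min (1 / 2) (d / (2 * L g + 1))); first by rewrite lt_min !divr_gt0.
    move=> r /andP[r0 r1]; rewrite lt_min distrC gtr0_norm ?subr_gt0 // => /andP[h1 h2].
    rewrite distrC ger0_norm; last first.
      by rewrite subr_ge0 -(powRr0 r) ger_powR // r0 ltW.
    rewrite /powR gt_eqF //.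
    have e1 := expR_ge1Dx (L g * ln r).
    have l1 : ln r^-1 <= r^-1 - 1.
      have {1}-> : r^-1 = 1 + (r^-1 - 1) by ring.
      apply: le_ln1Dx.
      by rewrite ltrBrDr addNr invr_gt0.
    rewrite lnV ?posrE // in l1.
    have rV : r^-1 - 1 <= 2 * (1 - r).
      have -> : r^-1 - 1 = (1 - r) / r by field; lra.
      by rewrite ler_pdivrMr //; nra.
    have {}h2 : (1 - r) * (2 * L g + 1) <= d by rewrite -ler_pdivlMr // ltW.
    have := L0 g; nra.
Qed.
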